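(* Let $1\le p\le\infty$, let $\alpha \in L^{1}(\mathbb{R})$ and let $w\in C^{1}(\mathbb{R})$ with $w(0)=0$. Consider the Cauchy problem $$u_{tt}(x,t)=\int_{\mathbb{R}} \alpha(y-x)\, w\big(u(y,t)-u(x,t)\big)\,dy,\quad x\in\mathbb{R},\ t>0,\qquad u(x,0)=\varphi(x),\ u_t(x,0)=\psi(x).$$ Then for initial data $\varphi,\psi\in L^{p}(\mathbb{R})\cap L^\infty(\mathbb{R})$ there is some $T>0$ such that this Cauchy problem is well posed with solution in $C^{2}([0,T],L^{p}(\mathbb{R})\cap L^\infty(\mathbb{R}))$.
   Context: $L^p(\mathbb{R})\cap L^\infty(\mathbb{R})$ carries the norm $\|u\|_p+\|u\|_\infty$. ''Well posed with solution in $C^2([0,T],X)$'' means: there exists a unique solution $u\in C^2([0,T],X)$ of the Cauchy problem, and the solution depends continuously on the initial data $(\varphi,\psi)\in X\times X$ (in the norm of $C([0,T],X)$). *)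

(* Defs.v *)
From HB Require Import structures.
From mathcomp Require Import all_boot all_order all_algebra.
From mathcomp Require Import all_classical all_reals all_analysis.
Set Implicit Arguments. Unset Strict Implicit. Unset Printing Implicit Defensive.
Import Order.TTheory GRing.Theory Num.Theory.
Import numFieldNormedType.Exports.
Local Open Scope classical_set_scope.
Local Open Scope ring_scope.

Section Defs.
Variable R : realType.
Local Notation mu := (@lebesgue_measure R).

Definition XN (p : \bar R) (f : R -> R) : \bar R :=
  ('N[mu]_p[EFin \o f] + 'N[mu]_(+oo%E)[EFin \o f])%E.

Definition inX (p : \bar R) (f : R -> R) : Prop :=
  measurable_fun [set: R] f /\ (XN p f < +oo)%E.

Definition inI (T t : R) : Prop := 0 <= t <= T.

Definition X_deriv (p : \bar R) (T : R) (u u' : R -> R -> R) : Prop :=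
  forall t, inI T t -> forall e : R, 0 < e -> exists d : R, 0 < d /\
    forall s, inI T s -> 0 < `|s - t| < d ->
      (XN p (fun x => ((u s x - u t x) / (s - t) - u' t x)%R) <= e%:E)%E.

Definition X_cont (p : \bar R) (T : R) (u : R -> R -> R) : Prop :=
  forall t, inI T t -> forall e : R, 0 < e -> exists d : R, 0 < d /\
    forall s, inI T s -> `|s - t| < d -> (XN p (fun x => (u s x - u t x)%R) <= e%:E)%E.

Definition C2X (p : \bar R) (T : R) (u u1 u2 : R -> R -> R) : Prop :=
  (forall t, inI T t -> inX p (u t) /\ inX p (u1 t) /\ inX p (u2 t)) /\
  X_deriv p T u u1 /\ X_deriv p T u1 u2 /\ X_cont p T u2.

Definition rhs (alpha w : R -> R) (v : R -> R) (x : R) : R :=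
  Rintegral mu [set: R] (fun y => alpha (y - x) * w (v y - v x)).

(* u is a solution in C^2([0,T], X) of the Cauchy problem with data (phi, psi);
   equalities in X are a.e. equalities *)
Definition is_solution (p : \bar R) (alpha w : R -> R) (T : R)
    (phi psi : R -> R) (u : R -> R -> R) : Prop :=
  exists u1 u2 : R -> R -> R,
    C2X p T u u1 u2 /\
    (forall t, 0 < t <= T -> {ae mu, forall x, u2 t x = rhs alpha w (u t) x}) /\
    {ae mu, forall x, u 0 x = phi x} /\
    {ae mu, forall x, u1 0 x = psi x}.

End Defs.

(* Main.v *)
(** Write the equation as the first order system [(u, v)' = (v, F u)] in [X * X], where
    [F u x] is the integral of [alpha (y - x) * w (u y - u x)] in [y]. Since [w] is
    Lipschitz on bounded intervals and [w 0 = 0], the difference [F u - F v] is dominated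
    by [|alpha| * |u - v|] (a convolution) plus a multiple of [|u - v|], so Young's
    convolution inequality makes [F] Lipschitz on bounded subsets of [X], for every [p].
    Local solutions are uniform limits of the explicit Euler scheme on dyadic grids: the
    Lipschitz bound controls the effect of halving the step, so that no integral of
    an [X]-valued function is needed. Uniqueness and continuous dependence follow from
    Gronwall's inequality for the seminorm of the difference of two solutions. *)

Require Import Defs.
From HB Require Import structures.
From mathcomp Require Import all_boot all_order all_algebra.
From mathcomp Require Import all_classical all_reals all_analysis.
From mathcomp Require Import ess_sup_inf measurable_realfun.
From mathcomp Require Import ring lra.
Set Implicit Arguments.
Unset Strict Implicit.
Unset Printing Implicit Defensive.
Import Order.TTheory GRing.Theory Num.Theory.
Import numFieldNormedType.Exports.
Local Open Scope classical_set_scope.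
Local Open Scope ring_scope.

(** * Differential inequalities *)

(** Functions that agree almost everywhere are not identified: [X] is a set of genuine functions
    inside the vector space [R -> R], and the abstract part works with a seminorm on a subset.
    Limits and initial values are thus determined up to seminorm 0, which in [X] means almost
    everywhere. The differential equation survives the limit because, between any two grid times,
    the Euler iterates satisfy a first order Taylor estimate whose quadratic remainder does not
    depend on the step; in the limit this estimate is differentiability and the equation at once.
    The field is Lipschitz on bounded sets only, and a competing solution comes with no a priori
    bound. It is compared with the constructed one only while their distance is at most 1, and
    smallness of the initial distance keeps it there. Existence time and stability constant are
    uniform over a unit ball of data, so that perturbed problems live on the same interval. The sup
    norm in [X] makes [w] Lipschitz along solutions, the convolutions finite at every point, and
    fast Cauchy sequences convergent almost everywhere. *)

(* The differential inequality is required only where [rho <= M], so that [rho]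
   may be a distance to a solution that is not known to stay bounded. *)
Lemma gronwall_bound (R : realType) (T L M : R) (rho : R -> R) :
  0 <= L -> (forall t, 0 <= t <= T -> 0 <= rho t) ->
  (forall t, 0 <= t <= T -> forall e, 0 < e -> exists d, 0 < d /\
     forall s, 0 <= s <= T -> `|s - t| < d -> rho t <= rho s + e) ->
  (forall t, 0 <= t <= T -> rho t <= M -> forall e, 0 < e -> exists d, 0 < d /\
     forall s, 0 <= s <= T -> t <= s -> s - t < d ->
       rho s <= rho t + (s - t) * (L * rho t + e)) ->
  rho 0 * expR (L * T) < M ->
  forall t, 0 <= t <= T -> rho t <= rho 0 * expR (L * t).
Proof.
move=> L0 rho0 lsc dini r0M t tT.
have T0 : 0 <= T by case/andP: tT; exact: le_trans.
set E := expR (L * T) in r0M *.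
have E0 : 0 < E by exact: expR_gt0.
have rho00 : 0 <= rho 0 by apply: rho0; rewrite lexx.
suff key e : 0 < e -> (rho 0 + e * T) * E <= M ->
    forall r, 0 <= r <= T -> rho r <= (rho 0 + e * r) * expR (L * r).
  apply/ler_addgt0Pr => eta eta0.
  have TE0 : 0 < (T + 1) * E by rewrite mulr_gt0//; lra.
  (* With slack [e = m / ((T + 1) * E)] the excess [e * T * E] is below both the tolerance [eta] and
     the gap [M - rho 0 * E], so the barrier stays below [M]. *)
  pose m := Num.min eta (M - rho 0 * E).
  have m0 : 0 < m by rewrite lt_min eta0 subr_gt0.
  have [m1 m2] : m <= eta /\ m <= M - rho 0 * E.
    by rewrite /m !ge_min !lexx orbT.
  have e0 : 0 < m / ((T + 1) * E) by rewrite divr_gt0.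
  have eTE : m / ((T + 1) * E) * T * E <= m.
    rewrite -mulrA mulrAC ler_pdivrMr// ler_pM2l// ler_pM2r//; lra.
  have := key _ e0 _ t tT; rewrite mulrDl => /(_ _)/le_trans; apply; first lra.
  rewrite mulrDl lerD2l (le_trans _ (le_trans eTE m1))//.
  case/andP: tT => t0 tT.
  rewrite ler_pM//; first by rewrite mulr_ge0// ltW.
  - by rewrite ler_pM2l.
  - by rewrite ler_expR ler_wpM2l.
move=> e0 eM.
pose b r := (rho 0 + e * r) * expR (L * r).
rewrite -/(b _).
have b_mono r s : 0 <= r -> r <= s -> b r <= b s.
  move=> r0 rs; rewrite ler_pM//.
  - by rewrite addr_ge0// mulr_ge0// ltW.
  - by rewrite lerD2l ler_pM2l.
  - by rewrite ler_expR ler_wpM2l.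
(* The barrier [b] gains at least what [dini] lets [rho] gain, so a short step that starts below it
   ends below it. *)
have b_grow r s : 0 <= r -> r <= s -> b r + (s - r) * (L * b r + e) <= b s.
  move=> r0 rs.
  have h1 : 0 <= L * (s - r) by rewrite mulr_ge0// subr_ge0.
  have h2 : 1 + L * (s - r) <= expR (L * (s - r)) := expR_ge1Dx _.
  have h3 : 1 <= expR (L * r) by rewrite -expR0 ler_expR mulr_ge0.
  have -> : b s = (rho 0 + e * s) * expR (L * r) * expR (L * (s - r)).
    by rewrite /b -mulrA -expRD; congr (_ * expR _); ring.
  have -> : (rho 0 + e * s) * expR (L * r) = b r + e * (s - r) * expR (L * r).
    by rewrite /b; ring.
  have b0 : 0 <= b r.
    by rewrite mulr_ge0 ?expR_ge0// addr_ge0// mulr_ge0// ltW.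
  have h4 : 0 <= e * (s - r) by rewrite mulr_ge0 ?subr_ge0// ltW.
  have h5 : e * (s - r) <= e * (s - r) * expR (L * r) by rewrite ler_peMr.
  have h6 : (b r + e * (s - r)) * (1 + L * (s - r)) <=
     (b r + e * (s - r) * expR (L * r)) * expR (L * (s - r)).
    by rewrite ler_pM// ?addr_ge0// lerD2l.
  apply: le_trans h6.
  have : 0 <= e * (s - r) * (L * (s - r)) by rewrite mulr_ge0.
  move: (b r) => br; nra.
(* Continuous induction: [lsc] carries the bound to the supremum [c] of the times up to which it
   holds, and [dini] carries it past [c] if [c < T]. *)
pose A := [set s | 0 <= s <= T /\ forall r, 0 <= r <= s -> rho r <= b r].
have A0 : A 0.
  split; first by rewrite lexx.
  move=> r r0; have -> : r = 0 by lra.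
  by rewrite /b !mulr0 expR0 addr0 mulr1.
have supA : has_sup A by split; [exists 0 | exists T => s [/andP[]]].
pose c := sup A.
have c0 : 0 <= c by apply: ub_le_sup A0; case: supA.
have cT : c <= T by apply: ge_sup; [exists 0|move=> s [/andP[]]].
have cI : 0 <= c <= T by rewrite c0.
have below r : 0 <= r -> r < c -> rho r <= b r.
  move=> r0 rc; have [s [_ As]] := sup_adherent (ltac:(by rewrite subr_gt0) : 0 < c - r) supA.
  by rewrite -/c opprB addrC subrK => rs; apply: As; rewrite r0 ltW.
have rhoc : rho c <= b c.
  rewrite leNgt; apply/negP => bc.
  have [|d [d0 Hd]] := lsc c cI ((rho c - b c) / 2); first by rewrite divr_gt0// subr_gt0.
  have [s As] := sup_adherent d0 supA; rewrite -/c => cds.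
  have sc : s <= c by apply: ub_le_sup As; case: supA.
  case: As => sT As; have s0 : 0 <= s by case/andP: sT.
  have := Hd s sT; rewrite ler0_norm ?subr_le0// => /(_ ltac:(lra)).
  have : rho s <= b s by apply: As; rewrite s0 lexx.
  have := b_mono _ _ s0 sc; lra.
suff -> : T = c.
  move=> r /andP[r0]; rewrite le_eqVlt => /predU1P[->//|]; exact: below.
apply/eqP; rewrite eq_le cT andbT leNgt; apply/negP => ltcT.
have rhocM : rho c <= M by apply: (le_trans rhoc); apply: le_trans eM; exact: b_mono.
have [d [d0 Hd]] := dini c cI rhocM e e0.
pose s := Num.min (c + d / 2) T.
have cs : c < s by rewrite lt_min ltcT andbT ltrDl divr_gt0.
have [sd sT] : s <= c + d / 2 /\ s <= T by rewrite /s !ge_min !lexx orbT.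
suff As : A s by have := ub_le_sup (proj2 supA) As; rewrite leNgt cs.
split; first by rewrite sT andbT (le_trans c0)// ltW.
move=> r /andP[r0 rs]; have [|cr] := ltP r c; first exact: below.
apply: le_trans (b_grow c r c0 cr).
apply: le_trans (Hd r _ cr _) _; [by rewrite r0 (le_trans rs)|lra|].
rewrite lerD// ler_wpM2l ?subr_ge0// lerD2r ler_wpM2l//.
Qed.

(** * The Euler scheme in a complete seminormed space *)

(** The domain [S] is a predicate because [N] will be [fine] of an extended norm, which is
    meaningless where that norm is infinite. Definiteness is not asked for: null functions have
    seminorm 0. *)
Record seminorm_on (R : realType) (V : lmodType R) (S : set V) (N : V -> R) : Prop := {
  dom0 : S 0;
  domD : forall x y, S x -> S y -> S (x + y);
  domZ : forall (a : R) x, S x -> S (a *: x);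
  snorm_ge0 : forall x, S x -> 0 <= N x;
  snormD : forall x y, S x -> S y -> N (x + y) <= N x + N y;
  snormZ : forall (a : R) x, S x -> N (a *: x) = `|a| * N x }.

(* No loss of generality: every Cauchy sequence has a subsequence of this kind. *)
Definition complete_on (R : realType) (V : lmodType R) (S : set V) (N : V -> R) :=
  forall (a : nat -> V) (C : R), (forall n, S (a n)) ->
    (forall n, N (a n.+1 - a n) <= C / 2 ^+ n) ->
    exists y, S y /\ forall e : R, 0 < e -> exists n0, forall n, (n0 <= n)%N -> N (a n - y) <= e.

Section Seminorm.
Context (R : realType) (V : lmodType R) (S : set V) (N : V -> R).
Context (sn : seminorm_on S N).

Lemma domN x : S x -> S (- x).
Proof. by move=> Sx; rewrite -scaleN1r; exact: (domZ sn). Qed.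

Lemma domB x y : S x -> S y -> S (x - y).
Proof. by move=> Sx Sy; apply: (domD sn) => //; exact: domN. Qed.

Lemma snorm0 : N 0 = 0.
Proof. by rewrite -(scale0r 0) (snormZ sn) ?normr0 ?mul0r//; exact: (dom0 sn). Qed.

Lemma snormN x : S x -> N (- x) = N x.
Proof. by move=> Sx; rewrite -scaleN1r (snormZ sn)// normrN1 mul1r. Qed.

Lemma snormBC x y : S x -> S y -> N (x - y) = N (y - x).
Proof. by move=> Sx Sy; rewrite -snormN ?opprB//; exact: domB. Qed.

Lemma snorm_triangle y x z : S x -> S y -> S z -> N (x - z) <= N (x - y) + N (y - z).
Proof.
move=> Sx Sy Sz; have -> : x - z = (x - y) + (y - z) by rewrite addrA subrK.
by apply: (snormD sn); exact: domB.
Qed.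

Lemma snormB_le x y : S x -> S y -> N (x - y) <= N x + N y.
Proof.
by move=> Sx Sy; rewrite -(snormN Sy); apply: (snormD sn) => //; exact: domN.
Qed.

Lemma snorm_le_add x y : S x -> S y -> N x <= N y + N (x - y).
Proof.
by move=> Sx Sy; rewrite -{1}(subrKC y x); apply: (snormD sn) => //; exact: domB.
Qed.

Lemma snormZ_ge0 (a : R) x : 0 <= a -> S x -> N (a *: x) = a * N x.
Proof. by move=> a0 Sx; rewrite (snormZ sn)// ger0_norm. Qed.

End Seminorm.

Section Euler.
Context (R : realType) (V : lmodType R) (S : set V) (N : V -> R).
Context (sn : seminorm_on S N) (cpl : complete_on S N).
Context (G : V -> V) (y0 : V) (r K L T : R).
Context (Sy0 : S y0) (K0 : 0 <= K) (L0 : 0 <= L) (T0 : 0 <= T).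
Context (KT : K * T <= r) (LT : L * T <= 1 / 2).
Context (SG : forall y, S y -> S (G y)).
Context (GK : forall y, S y -> N (y - y0) <= r -> N (G y) <= K).
Context (GL : forall y z, S y -> S z -> N (y - y0) <= r -> N (z - y0) <= r ->
  N (G y - G z) <= L * N (y - z)).

Definition euler (h : R) (k : nat) : V := iter k (fun y => y + h *: G y) y0.

Lemma eulerS h k : euler h k.+1 = euler h k + h *: G (euler h k).
Proof. by []. Qed.

Lemma euler_dom h k : S (euler h k).
Proof.
elim: k => [//|k IH]; rewrite eulerS; apply: (domD sn) => //.
by apply: (domZ sn); exact: SG.
Qed.

Local Hint Resolve euler_dom : core.
Let Sh := domB sn.
Let Sz := domZ sn.
Let SD := domD sn.
Local Hint Resolve Sh Sz SG SD : core.

(** The induction closes by [K * T <= r]: up to time [T] the iterates stay where [G] is bounded by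
    [K]. *)
Lemma euler_ball h k : 0 <= h -> h * k%:R <= T -> N (euler h k - y0) <= K * (h * k%:R).
Proof.
move=> h0; elim: k => [_|k IH kT]; first by rewrite subrr (snorm0 sn) !mulr0.
have {}kT : h * k%:R <= T by apply: le_trans kT; rewrite ler_wpM2l// ler_nat.
have {}IH := IH kT.
have gk : N (G (euler h k)) <= K.
  by apply: GK => //; apply: le_trans IH _; apply: le_trans KT; rewrite ler_wpM2l.
rewrite eulerS addrAC; apply: (le_trans (snormD sn _ _)); [by auto|by auto|].
rewrite (snormZ_ge0 sn)//; last by auto.
have := ler_wpM2l h0 gk; rewrite -natr1; lra.
Qed.

Lemma euler_ball_r h k : 0 <= h -> h * k%:R <= T -> N (euler h k - y0) <= r.
Proof.
move=> h0 kT; apply: le_trans (euler_ball h0 kT) _.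
by apply: le_trans KT; rewrite ler_wpM2l.
Qed.

Lemma euler_lipschitz h k i : 0 <= h -> h * (k + i)%:R <= T ->
  N (euler h (k + i) - euler h k) <= K * (h * i%:R).
Proof.
move=> h0; elim: i => [_|i IH]; first by rewrite addn0 subrr (snorm0 sn) !mulr0.
rewrite addnS => kT.
have {}kT : h * (k + i)%:R <= T by apply: le_trans kT; rewrite ler_wpM2l// ler_nat.
have {}IH := IH kT.
have gk : N (G (euler h (k + i))) <= K by apply: GK => //; exact: euler_ball_r.
rewrite eulerS addrAC; apply: (le_trans (snormD sn _ _)); [by auto|by auto|].
rewrite (snormZ_ge0 sn)//; last by auto.
have := ler_wpM2l h0 gk; rewrite -[i.+1%:R]natr1; lra.
Qed.

(** After [i] further steps the field has drifted by at most [L * K * (h * i)], by the Lipschitz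
    bounds on [G] and on the iterates; summing the drifts gives a remainder of second order in
    elapsed time, uniformly in [h]. *)
Lemma euler_taylor h k i : 0 <= h -> h * (k + i)%:R <= T ->
  N (euler h (k + i) - euler h k - (h * i%:R) *: G (euler h k)) <=
    L * K * (h * i%:R) ^+ 2.
Proof.
move=> h0; elim: i => [_|i IH].
  by rewrite addn0 subrr mulr0 scale0r subrr (snorm0 sn) expr2 !mulr0.
rewrite addnS => kT.
have {}kT : h * (k + i)%:R <= T by apply: le_trans kT; rewrite ler_wpM2l// ler_nat.
have kT' : h * k%:R <= T by apply: le_trans kT; rewrite ler_wpM2l// ler_nat leq_addr.
have {}IH := IH kT.
have gk : N (G (euler h (k + i)) - G (euler h k)) <= L * (K * (h * i%:R)).
  apply: le_trans (GL _ _ _ _) _ => //; rewrite ?euler_ball_r//.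
  by rewrite ler_wpM2l// euler_lipschitz.
rewrite eulerS.
have -> : euler h (k + i) + h *: G (euler h (k + i)) - euler h k -
    (h * i.+1%:R) *: G (euler h k) =
  (euler h (k + i) - euler h k - (h * i%:R) *: G (euler h k)) +
  h *: (G (euler h (k + i)) - G (euler h k)).
  rewrite -natr1 mulrDr mulr1 scalerDl scalerBr opprD !addrA.
  congr (_ - _); rewrite -!addrA; congr (_ + _); rewrite addrC -!addrA.
  by congr (_ + _); rewrite addrC.
apply: (le_trans (snormD sn _ _)); [by auto 10|by auto 10|].
rewrite (snormZ_ge0 sn)//; last by auto.
have := ler_wpM2l h0 gk; rewrite -[i.+1%:R]natr1.
have : 0 <= L * K * (h ^+ 2 * i%:R) by rewrite !mulr_ge0// sqr_ge0.
have : 0 <= L * K * (h ^+ 2) by rewrite !mulr_ge0// sqr_ge0.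
nra.
Qed.

(** Two half steps differ from a full step in that the second one evaluates [G] at a point moved by
    at most [K * (h / 2)]. This costs [L * K * h ^+ 2 / 4] per step, plus the propagation of the
    earlier error. *)
Lemma euler_refine h k : 0 <= h -> h * k%:R <= T ->
  N (euler (h / 2) k.*2 - euler h k) <= L * K * k%:R * h ^+ 2.
Proof.
move=> h0; elim: k => [_|k IH kT].
  by rewrite subrr (snorm0 sn) mulr0 mul0r.
have half m : h / 2 * m.*2%:R = h * m%:R.
  by rewrite -muln2 natrM; field.
have h20 : 0 <= h / 2 by rewrite divr_ge0.
have kT1 : h * k%:R <= T by apply: le_trans kT; rewrite ler_wpM2l// ler_nat.
have {}IH := IH kT1.
have kT2 : h / 2 * k.*2%:R <= T by rewrite half.
have kT3 : h / 2 * (k.*2 + 1)%:R <= T.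
  by apply: le_trans kT; rewrite -half ler_wpM2l// ler_nat addn1 doubleS.
set E := euler h k in IH *; set E2 := euler (h / 2) k.*2 in IH *.
set E3 := euler (h / 2) (k.*2 + 1).
have E3E : euler (h / 2) (k.*2).+1 = E3 by rewrite /E3 addn1.
have g1 : N (G E2 - G E) <= L * (L * K * k%:R * h ^+ 2).
  apply: le_trans (GL _ _ _ _) _; rewrite ?euler_ball_r//; try exact: euler_dom.
  by rewrite ler_wpM2l.
have g2 : N (G E3 - G E) <= L * (K * (h / 2) + L * K * k%:R * h ^+ 2).
  apply: le_trans (GL _ _ _ _) _; rewrite ?euler_ball_r//; try exact: euler_dom.
  rewrite ler_wpM2l//; apply: le_trans (snorm_triangle sn (y := E2) _ _ _) _; try exact: euler_dom.
  by rewrite lerD//; have := euler_lipschitz h20 kT3; rewrite mulr1.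
have E3E2 : E3 = E2 + (h / 2) *: G E2 by rewrite -E3E.
rewrite doubleS eulerS E3E eulerS -/E {1}E3E2.
have -> : E2 + (h / 2) *: G E2 + (h / 2) *: G E3 - (E + h *: G E) =
  (E2 - E) + ((h / 2) *: (G E2 - G E) + (h / 2) *: (G E3 - G E)).
  have -> : h *: G E = (h / 2) *: G E + (h / 2) *: G E by rewrite -scalerDl -splitr.
  by rewrite !scalerBr -(addrA E2) opprD addrACA opprD (addrACA (_ *: _)).
have SE : S E by exact: euler_dom.
have SE2 : S E2 by exact: euler_dom.
have SE3 : S E3 by exact: euler_dom.
apply: (le_trans (snormD sn _ _)); [by auto 10|by auto 10|].
apply: (le_trans (lerD IH (snormD sn _ _))); [by auto 10|by auto 10|].
rewrite !(snormZ_ge0 sn)//; [|by auto..].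
have := ler_wpM2l h20 g1; have := ler_wpM2l h20 g2; rewrite -[k.+1%:R]natr1.
(* With [X = L * K * h ^+ 2], one step adds [X / 4 + X * (L * (h * k%:R))], at most [X] by
   [L * T <= 1 / 2]: the error stays linear in [k], with no exponential factor. *)
have : L * (h * k%:R) <= 1 / 2 by apply: le_trans LT; rewrite ler_wpM2l.
have : 0 <= L * K * h ^+ 2 by rewrite !mulr_ge0// sqr_ge0.
set X := L * K * h ^+ 2.
have -> : L * K * k%:R * h ^+ 2 = X * k%:R by rewrite /X; ring.
have -> : L * K * (k%:R + 1) * h ^+ 2 = X * (k%:R + 1) by rewrite /X; ring.
have -> : h / 2 * (L * (K * (h / 2) + X * k%:R)) = X / 4 + X * (L * (h * k%:R)) / 2.
  by rewrite /X; field.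
have -> : h / 2 * (L * (X * k%:R)) = X * (L * (h * k%:R)) / 2.
  by field.
move: (L * (h * k%:R)) => B X0 B12; nra.
Qed.


(** * Dyadic grids and passage to the limit *)

Definition grid (n : nat) (t : R) : nat := Num.trunc (t * 2 ^+ n).

Lemma grid_bounds n t : 0 <= t ->
  2 ^- n * (grid n t)%:R <= t < 2 ^- n * (grid n t)%:R + 2 ^- n.
Proof.
move=> t0; have p0 : 0 < 2 ^+ n :> R by rewrite exprn_gt0.
have /andP[] := truncn_itv (mulr_ge0 t0 (ltW p0)); rewrite -/(grid n t) => h1 h2.
rewrite mulrC ler_pdivrMr// h1/= -[X in _ + X]mul1r -mulrDl natr1.
by rewrite ltr_pdivlMr.
Qed.

(** The point of the finer grid just before [t] is the old one or the midpoint that follows it. *)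
Lemma gridS n t : 0 <= t -> exists b : bool, grid n.+1 t = ((grid n t).*2 + b)%N.
Proof.
move=> t0; have p0 : 0 < 2 ^+ n :> R by rewrite exprn_gt0.
have tp := mulr_ge0 t0 (ltW p0).
have /andP[] := truncn_itv tp; rewrite -/(grid n t) => h1 h2.
have tE : t * 2 ^+ n.+1 = 2 * (t * 2 ^+ n) by rewrite exprS; ring.
have [lt|ge] := ltP (t * 2 ^+ n.+1) ((grid n t).*2.+1)%:R.
  exists false; rewrite /= addn0; apply: truncn_def; rewrite lt andbT tE.
  by rewrite -mul2n natrM ler_wpM2l.
exists true; rewrite addn1; apply: truncn_def; rewrite ge/= tE -doubleS -mul2n natrM.
by rewrite ltr_pM2l.
Qed.

Lemma grid_mono n s t : 0 <= s -> s <= t -> (grid n s <= grid n t)%N.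
Proof. by move=> s0 st; apply: le_truncn; rewrite ler_wpM2r// exprn_ge0. Qed.

Let a t n := euler (2 ^- n) (grid n t).

Let hn0 n : 0 <= 2 ^- n :> R. Proof. by rewrite invr_ge0 exprn_ge0. Qed.

Let grid_T n (t : R) : 0 <= t <= T -> 2 ^- n * (grid n t)%:R <= T.
Proof. by case/andP=> t0; apply: le_trans; have /andP[] := grid_bounds n t0. Qed.

(** Halving the step costs at most [L * K * T / 2 ^+ n]; the possible extra half step, when the grid
    point moves to a midpoint, costs at most [K / 2 ^+ n]. *)
Lemma euler_cauchy t n : 0 <= t <= T -> N (a t n.+1 - a t n) <= (L * K * T + K) / 2 ^+ n.
Proof.
move=> tT; have t0 : 0 <= t by case/andP: tT.
have [b gE] := gridS n t0.
have kT := grid_T n tT; have kT' := grid_T n.+1 tT.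
rewrite /a gE; rewrite gE in kT'.
have hE : 2 ^- n.+1 = 2 ^- n / 2 :> R by rewrite exprS invfM mulrC.
rewrite hE in kT' *.
apply: le_trans (snorm_triangle sn (y := euler (2 ^- n / 2) (grid n t).*2) _ _ _) _ => //.
have h20 : 0 <= 2 ^- n / 2 :> R by rewrite divr_ge0.
have h1 := euler_lipschitz h20 kT'.
have h2 := euler_refine (hn0 n) kT.
apply: le_trans (lerD h1 h2) _.
rewrite addrC mulrDl lerD//.
  have -> : L * K * (grid n t)%:R * (2 ^- n) ^+ 2 = L * K * (2 ^- n * (grid n t)%:R) * 2 ^- n.
    by ring.
  by rewrite ler_wpM2r// ler_wpM2l// mulr_ge0.
rewrite ler_wpM2l//; case: b {gE kT' h1} => /=; rewrite ?mulr0// mulr1.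
by rewrite ler_pdivrMr// ler_peMr//; lra.
Qed.

(** Lets several errors tend to 0 together; [eta <= 1] allows [eta ^+ 2] to be counted as [eta]. *)
Let le_eps (x z C : R) : (forall eta : R, 0 < eta -> eta <= 1 -> x <= z + C * eta) -> x <= z.
Proof.
move=> H; apply/ler_addgt0Pr => e e0.
have C0 : 0 < `|C| + 1 by rewrite ltr_wpDl.
have := H (Num.min 1 (e / (`|C| + 1))).
rewrite lt_min ltr01 divr_gt0// ge_min lexx => /(_ isT isT)/le_trans; apply.
rewrite lerD2l; apply: le_trans (ler_norm _) _; rewrite normrM.
rewrite (@ger0_norm _ (Num.min _ _)); last by rewrite le_min ler01 divr_ge0// ltW.
apply: (@le_trans _ _ (`|C| * (e / (`|C| + 1)))).
  by rewrite ler_wpM2l// ge_min lexx orbT.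
by rewrite mulrCA ler_piMr ?(ltW e0)// ler_pdivrMr//; lra.
Qed.

(** The last clause is the limit of [euler_taylor]: it says that [y] has derivative [G (y t)], with
    a uniform rate. The factor 3 is only needed for backward increments. *)
Lemma euler_limit : exists y : R -> V,
  (forall t : R, 0 <= t <= T -> S (y t) /\ N (y t - y0) <= r) /\ N (y 0 - y0) <= 0 /\
  (forall s t : R, 0 <= s <= T -> 0 <= t <= T ->
    N (y s - y t - (s - t) *: G (y t)) <= 3 * (L * K) * (s - t) ^+ 2).
Proof.
have /choice[y yP] : forall t : R, exists yt, 0 <= t <= T -> S yt /\
    forall e : R, 0 < e -> exists n0, forall n, (n0 <= n)%N -> N (a t n - yt) <= e.
  move=> t; have [tT|tT] := boolP (0 <= t <= T); last by exists 0.
  have [yt ytP] := @cpl (a t) (L * K * T + K) (fun=> euler_dom _ _)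
    (fun n => euler_cauchy n tT).
  by exists yt.
exists y.
have Sy (t : R) : 0 <= t <= T -> S (y t) by case/yP.
have SGy (t : R) : 0 <= t <= T -> S (G (y t)) by move=> /Sy; exact: SG.
have ball (t : R) : 0 <= t <= T -> N (y t - y0) <= r.
  move=> tT; apply/ler_addgt0Pr => e e0; have [Syt /(_ _ e0)[n Hn]] := yP t tT.
  apply: le_trans (snorm_triangle sn (y := a t n) _ _ _) _ => //; first exact: euler_dom.
  rewrite addrC lerD// ?euler_ball_r//; first exact: grid_T.
  by rewrite (snormBC sn)//; [exact: Hn|exact: euler_dom].
split; first by move=> t tT; split; [exact: Sy|exact: ball].
have I0 : (0 : R) <= 0 <= T by rewrite lexx.
split.
  apply/ler_addgt0Pr => e e0; have [Syt /(_ _ e0)[n Hn]] := yP 0 I0.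
  have a0 : a 0 n = y0 by rewrite /a /grid mul0r truncn0.
  by rewrite add0r (snormBC sn)// -{1}a0 Hn.
have fwd (s t : R) : 0 <= s <= T -> 0 <= t <= T -> t <= s ->
    N (y s - y t - (s - t) *: G (y t)) <= (L * K) * (s - t) ^+ 2.
  move=> sT tT ts.
  (* [eta] bounds the mesh and the distances of the iterates at [s] and [t] to their limits. The
     constant collects these distances and the change of [G] at the base point (the 3), the rounding
     of [s - t] in the quadratic term, and its rounding in front of [G (y t)] (the [K]). *)
  apply: (@le_eps _ _ (3 + L * K * (2 * T + 1) + K)) => eta eta0 eta1.
  have [Sys /(_ _ eta0)[ns Hs]] := yP s sT; have [Syt /(_ _ eta0)[nt Ht]] := yP t tT.
  have [nh Hh] : exists nh, forall n, (nh <= n)%N -> 2 ^- n <= eta.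
    exists (Num.trunc eta^-1).+1 => n nhn.
    rewrite invf_ple ?posrE ?exprn_gt0//.
    apply: ltW; apply: (@lt_le_trans _ _ (Num.trunc eta^-1).+1%:R); first exact: truncnS_gt.
    rewrite -natrX ler_nat; apply: leq_trans nhn _; apply: ltnW; exact: ltn_expl.
  pose n := maxn nh (maxn ns nt).
  have {}Hh : 2 ^- n <= eta by apply: Hh; rewrite leq_maxl.
  have {}Hs : N (a s n - y s) <= eta by apply: Hs; rewrite /n !leq_max leqnn !orbT.
  have {}Ht : N (a t n - y t) <= eta by apply: Ht; rewrite /n !leq_max leqnn !orbT.
  have t0 : 0 <= t by case/andP: tT.
  have s0 : 0 <= s by case/andP: sT.
  have /andP[g1 g2] := grid_bounds n t0; have /andP[g3 g4] := grid_bounds n s0.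
  pose k := grid n t; pose i := (grid n s - k)%N.
  have gE : grid n s = (k + i)%N by rewrite subnKC// grid_mono.
  have Sat : S (a t n) by exact: euler_dom.
  have Sas : S (a s n) by exact: euler_dom.
  pose hi : R := 2 ^- n * i%:R.
  have gsE : 2 ^- n * (grid n s)%:R = 2 ^- n * k%:R + hi by rewrite gE natrD mulrDr.
  have hi0 : 0 <= hi by rewrite mulr_ge0.
  have kT : 2 ^- n * (k + i)%:R <= T by rewrite -gE grid_T.
  have hiT : hi <= T.
    by apply: le_trans kT; rewrite ler_wpM2l// ler_nat leq_addl.
  have hist : `|hi - (s - t)| <= eta.
    by rewrite ler_distl; apply/andP; split; move: gsE g1 g2 g3 g4 Hh; rewrite -/k; lra.
  have b1 : N (a s n - (a t n + hi *: G (a t n))) <= L * K * hi ^+ 2.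
    by rewrite opprD addrA /a gE; exact: euler_taylor.
  have b2 : N (G (a t n) - G (y t)) <= L * eta.
    apply: le_trans (GL _ _ _ _) _ => //; [by rewrite euler_ball_r// grid_T|exact: ball|].
    by rewrite ler_wpM2l.
  have b3 : N (G (y t)) <= K by apply: GK => //; exact: ball.
  rewrite -addrA -opprD.
  have SGa : S (G (a t n)) by exact: SG.
  have SGyt : S (G (y t)) by exact: SG.
  apply: le_trans (snorm_triangle sn (y := a s n) _ _ _) _; [by auto..|].
  apply: le_trans (lerD (lexx _) (snorm_triangle sn (y := a t n + hi *: G (a t n)) _ _ _)) _;
    [by auto..|].
  apply: le_trans (lerD (lexx _) (lerD (lexx _)
     (snorm_triangle sn (y := y t + hi *: G (a t n)) _ _ _))) _; [by auto..|].
  apply: le_trans (lerD (lexx _) (lerD (lexx _) (lerD (lexx _)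
     (snorm_triangle sn (y := y t + hi *: G (y t)) _ _ _)))) _; [by auto..|].
  have cancelr (x x' z : V) : (x + z) - (x' + z) = x - x' by rewrite opprD addrACA subrr addr0.
  have cancell (x x' z : V) : (z + x) - (z + x') = x - x' by rewrite opprD addrACA subrr add0r.
  rewrite cancelr !cancell -scalerBr -scalerBl (snormZ_ge0 sn)//; last by auto.
  rewrite (snormZ sn)// (snormBC sn (x := y s))//.
  have c1 : hi * N (G (a t n) - G (y t)) <= eta / 2.
    apply: (@le_trans _ _ (hi * (L * eta))); first by rewrite ler_wpM2l.
    have hL : hi * L <= 1 / 2 by rewrite mulrC (le_trans _ LT)// ler_wpM2l.
    have := ler_wpM2r (ltW eta0) hL; lra.
  have c2 : `|hi - (s - t)| * N (G (y t)) <= eta * K.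
    by rewrite ler_pM// (snorm_ge0 sn).
  have c3 : L * K * hi ^+ 2 <= L * K * (s - t) ^+ 2 + L * K * (2 * T + 1) * eta.
    rewrite -(mulrA (L * K) (_ + _)) -mulrDr ler_wpM2l ?mulr_ge0//.
    move: hist; rewrite ler_distl => /andP[h1 h2].
    have sT' : s <= T by case/andP: sT.
    apply: (@le_trans _ _ ((s - t + eta) ^+ 2)).
      by rewrite ler_sqr ?nnegrE// addr_ge0 ?subr_ge0// ltW.
    nra.
  have := lerD Hs (lerD b1 (lerD Ht (lerD c1 c2))) => /le_trans; apply.
  move: c3; set X := L * K * _ ^+ 2; nra.
have lip (s t : R) : 0 <= s <= T -> 0 <= t <= T -> t <= s -> N (y s - y t) <= 2 * K * (s - t).
  move=> sT tT ts.
  have d0 : 0 <= s - t by rewrite subr_ge0.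
  have := snorm_le_add sn (x := y s - y t) (y := (s - t) *: G (y t)).
  move=> /(_ ltac:(by auto) ltac:(by auto))/le_trans; apply.
  rewrite (snormZ_ge0 sn)//; last by auto.
  have h1 := fwd _ _ sT tT ts.
  have h2 : N (G (y t)) <= K by apply: GK; auto.
  have h3 : L * (s - t) <= 1 / 2.
    apply: le_trans LT; rewrite ler_wpM2l//.
    by case/andP: sT => _ sT; case/andP: tT => t0 _; lra.
  have h4 : (s - t) * N (G (y t)) <= (s - t) * K by rewrite ler_wpM2l.
  have h5 : L * K * (s - t) ^+ 2 <= 1 / 2 * (K * (s - t)).
    have -> : L * K * (s - t) ^+ 2 = L * (s - t) * (K * (s - t)) by ring.
    by rewrite ler_wpM2r// mulr_ge0.
  have h6 : 0 <= K * (s - t) by rewrite mulr_ge0.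
  lra.
move=> s t sT tT; have [ts|/ltW st] := leP t s.
  apply: le_trans (fwd _ _ sT tT ts) _; rewrite ler_wpM2r ?sqr_ge0//.
  have := mulr_ge0 L0 K0; lra.
(* For backward increments, expand at [s] and replace [G (y s)] by [G (y t)]: this adds
   [2 * (L * K)] to the forward constant. *)
have d0 : 0 <= t - s by rewrite subr_ge0.
have -> : y s - y t - (s - t) *: G (y t) =
   - (y t - y s - (t - s) *: G (y s)) + (t - s) *: (G (y t) - G (y s)).
  rewrite scalerBr -(opprB t s) scaleNr opprK (opprB (_ - _)) [RHS]addrC addrA subrK.
  by rewrite opprB addrC.
apply: (le_trans (snormD sn _ _)); [by apply: (domN sn); auto|by auto|].
rewrite (snormN sn); last by auto.
rewrite (snormZ_ge0 sn)//; last by auto.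
have h1 := fwd _ _ tT sT st.
have h2 : N (G (y t) - G (y s)) <= L * (2 * K * (t - s)).
  by apply: le_trans (GL _ _ _ _) _; auto; rewrite ler_wpM2l// lip.
have := ler_wpM2l d0 h2; rewrite -(opprB t s) sqrrN; nra.
Qed.

End Euler.

(** * The Cauchy problem for a locally Lipschitz field *)

(** The difference quotient is multiplied out, so that [s = t] need not be excluded; at the
    endpoints the derivative is one-sided. *)
Definition deriv_on (R : realType) (V : lmodType R) (N : V -> R) (T : R) (y y' : R -> V) :=
  forall t : R, 0 <= t <= T -> forall e : R, 0 < e -> exists d : R, 0 < d /\
    forall s : R, 0 <= s <= T -> `|s - t| < d ->
      N (y s - y t - (s - t) *: y' t) <= e * `|s - t|.

Section Cauchy.
Context (R : realType) (V : lmodType R) (S : set V) (N : V -> R).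
Context (sn : seminorm_on S N).

Lemma deriv_on_growth (T : R) (y y' : R -> V) :
  (forall t : R, 0 <= t <= T -> S (y t) /\ S (y' t)) -> deriv_on N T y y' ->
  forall t : R, 0 <= t <= T -> forall e : R, 0 < e -> exists d : R, 0 < d /\
    forall s : R, 0 <= s <= T -> `|s - t| < d -> N (y s - y t) <= `|s - t| * (N (y' t) + e).
Proof.
move=> Sy dy t tT e e0; have [d [d0 Hd]] := dy t tT e e0; exists d; split=> // s sT st.
have [Sys _] := Sy s sT; have [Syt Sy't] := Sy t tT.
have h1 : S (y s - y t) by exact: (domB sn).
have h2 : S ((s - t) *: y' t) by exact: (domZ sn).
apply: le_trans (snorm_le_add sn h1 h2) _.
by rewrite mulrDr (snormZ sn)// lerD2l mulrC; apply: Hd.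
Qed.

Lemma deriv_on_sub (T : R) (y y' z z' : R -> V) :
  (forall t : R, 0 <= t <= T -> S (y t) /\ S (y' t)) ->
  (forall t : R, 0 <= t <= T -> S (z t) /\ S (z' t)) ->
  deriv_on N T y y' -> deriv_on N T z z' ->
  deriv_on N T (fun t => y t - z t) (fun t => y' t - z' t).
Proof.
move=> Sy Sz dy dz t tT e e0; have e20 : 0 < e / 2 by rewrite divr_gt0.
have [d1 [d10 H1]] := dy t tT _ e20; have [d2 [d20 H2]] := dz t tT _ e20.
exists (Num.min d1 d2); rewrite lt_min d10 d20; split=> // s sT.
rewrite lt_min => /andP[st1 st2].
have [Sys _] := Sy s sT; have [Syt Sy't] := Sy t tT.
have [Szs _] := Sz s sT; have [Szt Sz't] := Sz t tT.
have -> : y s - z s - (y t - z t) - (s - t) *: (y' t - z' t) =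
  (y s - y t - (s - t) *: y' t) - (z s - z t - (s - t) *: z' t).
  have subACA (a b c d : V) : a - b - (c - d) = a - c - (b - d).
    by rewrite opprD addrACA -opprD.
  by rewrite scalerBr [RHS]subACA (subACA (y s)).
have h1 : S (y s - y t - (s - t) *: y' t) by apply: (domB sn); [exact: (domB sn)|exact: (domZ sn)].
have h2 : S (z s - z t - (s - t) *: z' t) by apply: (domB sn); [exact: (domB sn)|exact: (domZ sn)].
apply: le_trans (snormB_le sn h1 h2) _.
have := H1 s sT st1; have := H2 s sT st2; lra.
Qed.

(** [N (w t)] need not be differentiable, but its increments are bounded by those of [w], which is
    all that [gronwall_bound] asks for. *)
Lemma deriv_on_gronwall (T L M : R) (w w' : R -> V) : 0 <= L ->
  (forall t : R, 0 <= t <= T -> S (w t) /\ S (w' t)) -> deriv_on N T w w' ->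
  (forall t : R, 0 <= t <= T -> N (w t) <= M -> N (w' t) <= L * N (w t)) ->
  N (w 0) * expR (L * T) < M ->
  forall t : R, 0 <= t <= T -> N (w t) <= N (w 0) * expR (L * t).
Proof.
move=> L0 Sw dw ww; apply: (@gronwall_bound _ T L M (fun t => N (w t))) => //.
- by move=> t /Sw[Swt _]; exact: (snorm_ge0 sn).
- move=> t tT e e0; have [Swt Sw't] := Sw t tT.
  have [d [d0 Hd]] := deriv_on_growth Sw dw tT ltr01.
  have c0 : 0 < N (w' t) + 1 by rewrite ltr_wpDl// (snorm_ge0 sn).
  exists (Num.min d (e / (N (w' t) + 1))); rewrite lt_min d0 divr_gt0//; split=> // s sT.
  rewrite lt_min => /andP[sd]; rewrite ltr_pdivlMr// => se.
  have [Sws _] := Sw s sT.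
  apply: le_trans (snorm_le_add sn Swt Sws) _; rewrite lerD2l (snormBC sn)//.
  exact: le_trans (Hd s sT sd) (ltW se).
- move=> t tT tM e e0; have [Swt Sw't] := Sw t tT.
  have [d [d0 Hd]] := deriv_on_growth Sw dw tT e0.
  exists d; split=> // s sT ts std; have [Sws _] := Sw s sT.
  apply: le_trans (snorm_le_add sn Sws Swt) _; rewrite lerD2l.
  have st0 : 0 <= s - t by rewrite subr_ge0.
  apply: le_trans (Hd s sT _) _; rewrite ger0_norm// ler_wpM2l// lerD2r.
  exact: ww.
Qed.

Context (cpl : complete_on S N) (G : V -> V).
Context (SG : forall y, S y -> S (G y)).
Context (GL : forall M : R, exists2 L : R, 0 <= L & forall y z, S y -> S z ->
  N y <= M -> N z <= M -> N (G y - G z) <= L * N (y - z)).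

Lemma deriv_on_quadratic (C T : R) (y y' : R -> V) : 0 <= C ->
  (forall s t : R, 0 <= s <= T -> 0 <= t <= T ->
    N (y s - y t - (s - t) *: y' t) <= C * (s - t) ^+ 2) -> deriv_on N T y y'.
Proof.
move=> C0 H t tT e e0; have C1 : 0 < C + 1 by rewrite ltr_wpDl.
exists (e / (C + 1)); rewrite divr_gt0//; split=> // s sT; rewrite ltr_pdivlMr// => st.
apply: le_trans (H s t sT tT) _; rewrite -real_normK ?num_real// expr2 mulrA.
rewrite ler_wpM2r//; apply: le_trans (ltW st); rewrite mulrC ler_wpM2l//; lra.
Qed.

(* The existence time depends only on a bound on the data, hence is uniform near [y0]. *)
Theorem local_well_posed (y0 : V) : S y0 -> exists T C : R, [/\ 0 < T, 0 < C &
  forall y0', S y0' -> N (y0' - y0) <= 1 -> exists y : R -> V,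
  [/\ forall t : R, 0 <= t <= T -> S (y t), N (y 0 - y0') = 0,
      deriv_on N T y (G \o y) &
      forall z : R -> V, (forall t : R, 0 <= t <= T -> S (z t)) ->
        deriv_on N T z (G \o z) -> C * N (z 0 - y0') < 1 ->
        forall t : R, 0 <= t <= T -> N (z t - y t) <= C * N (z 0 - y0')]].
Proof.
(* The 3 is one unit each for the distance of [y0'] to [y0], of the constructed solution to [y0'],
   and of a competitor to the constructed solution. *)
move=> Sy0; pose M := N y0 + 3; have [L L0 GLM] := GL M.
have Ny00 : 0 <= N y0 by exact: (snorm_ge0 sn).
have S0 := dom0 sn; have SG0 : S (G 0) by exact: SG.
have NG0 : 0 <= N (G 0) by exact: (snorm_ge0 sn).
pose K := L * M + N (G 0).
have K0 : 0 <= K by rewrite addr_ge0// mulr_ge0// /M; lra.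
have GK y : S y -> N y <= M -> N (G y) <= K.
  move=> Sy yM; apply: le_trans (snorm_le_add sn (SG Sy) SG0) _.
  rewrite addrC lerD2r; apply: le_trans (GLM _ _ Sy S0 yM _) _.
    by rewrite (snorm0 sn) /M; lra.
  by rewrite subr0 ler_wpM2l.
(* Chosen so that [T = D^-1] satisfies [K * T <= 1], with radius 1 for the ball, and
   [L * T <= 1 / 2]. *)
pose D := 2 * (K + L + 1).
have D0 : 0 < D by rewrite /D; lra.
pose T := D^-1.
have T0 : 0 < T by rewrite invr_gt0.
exists T, (expR (L * T)); split=> // [|y0' Sy0' dy0]; first exact: expR_gt0.
have y0'M : N y0' <= N y0 + 1 by apply: le_trans (snorm_le_add sn Sy0' Sy0) _; rewrite lerD2l.
have ballM r y : S y -> N (y - y0') <= r -> N y <= N y0 + 1 + r.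
  by move=> Sy yr; apply: le_trans (snorm_le_add sn Sy Sy0') _; exact: lerD.
have KT : K * T <= 1 by rewrite ler_pdivrMr// /D; lra.
have LT : L * T <= 1 / 2 by rewrite ler_pdivrMr// /D; lra.
have GK' y : S y -> N (y - y0') <= 1 -> N (G y) <= K.
  by move=> Sy /(ballM _ _ Sy) h; apply: GK => //; rewrite /M; lra.
have GL' y z : S y -> S z -> N (y - y0') <= 1 -> N (z - y0') <= 1 ->
    N (G y - G z) <= L * N (y - z).
  move=> Sy Sz /(ballM _ _ Sy) h1 /(ballM _ _ Sz) h2; apply: GLM => //; rewrite /M; lra.
have [y [yB [y00 yD]]] := euler_limit sn cpl Sy0' K0 L0 (ltW T0) KT LT SG GK' GL'.
have I0 : (0 : R) <= 0 <= T by rewrite lexx ltW.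
have Sy t : 0 <= t <= T -> S (y t) by case/yB.
have {}y00 : N (y 0 - y0') = 0.
  by apply/eqP; rewrite eq_le y00 (snorm_ge0 sn)//; apply: (domB sn) => //; exact: Sy.
have dy : deriv_on N T y (G \o y).
  by apply: deriv_on_quadratic yD; rewrite !mulr_ge0.
exists y; split=> // z Sz dz zC t tT.
have Sy0t := Sy 0 I0; have Sz0t := Sz 0 I0.
have zy0 : N (z 0 - y 0) <= N (z 0 - y0').
  apply: le_trans (snorm_triangle sn Sz0t Sy0' Sy0t) _.
  by rewrite (snormBC sn Sy0' Sy0t) y00 addr0.
have SD (v : R -> V) (r : R) : (forall t : R, 0 <= t <= T -> S (v t)) ->
  0 <= r <= T -> S (v r) /\ S ((G \o v) r).
  by move=> Sv /Sv Svr; split=> //=; exact: SG.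
have E0 : 0 < expR (L * T) by exact: expR_gt0.
(* Threshold 1: while [z] is within 1 of [y], both lie in the ball of radius [M] where [L] is valid;
   [C * N (z 0 - y0') < 1] keeps the Gronwall bound below it. *)
have := @deriv_on_gronwall T L 1 (fun t => z t - y t) (fun t => G (z t) - G (y t)) L0.
move=> /(_ _ _ _ _ t tT)/le_trans; apply.
- move=> r rT; have [? ?] := SD z r Sz rT; have [? ?] := SD y r Sy rT.
  by split; exact: (domB sn).
- by apply: deriv_on_sub dz dy => r rT; exact: SD.
- move=> r rT zy1; have [Syr yr] := yB r rT.
  apply: GLM => //; [exact: Sz| |by have := ballM _ _ Syr yr; rewrite /M; lra].
  apply: le_trans (snorm_le_add sn (Sz r rT) Syr) _.
  by have := ballM _ _ Syr yr; rewrite /M; lra.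
- by apply: le_lt_trans zC; rewrite mulrC ler_wpM2l// ltW.
rewrite mulrC ler_pM ?expR_ge0 ?(snorm_ge0 sn)//; first exact: (domB sn).
by rewrite ler_expR ler_wpM2l//; case/andP: tT.
Qed.

End Cauchy.

(** * The space [X] *)

(* The library's hint does not recognize the bare function [lebesgue_measure] as a measure. *)
Instance lebesgue_ae_filter (R : realType) :
  Filter (nbhs (almost_everywhere (@lebesgue_measure R))).
Proof. exact: (@ae_filter_ringOfSetsType _ _ _ (@lebesgue_measure R)). Qed.

(** * Lebesgue norms of real functions *)

Section Norm.
Context (R : realType).
Local Notation mu := (@lebesgue_measure R).
Implicit Types (f g : R -> R) (p : \bar R).

(** Selects the essential supremum in the definition of the norm of exponent [+oo]. *)
Lemma lebesgue_measure_setT_gt0 : (0 < mu [set: R])%E.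
Proof. by rewrite -set_itvNyy lebesgue_measure_itv /= lt0y. Qed.

Lemma LnormyP f (c : R) : ('N[mu]_+oo[EFin \o f] <= c%:E)%E <-> {ae mu, forall x, `|f x| <= c}.
Proof.
rewrite unlock lebesgue_measure_setT_gt0; split.
  by move/ess_supP => h; apply: filterS h => x; rewrite /= lee_fin.
by move=> h; apply/ess_supP; apply: filterS h => x; rewrite /= lee_fin.
Qed.

Lemma measurable_powR_norm f (r : R) : measurable_fun [set: R] f ->
  measurable_fun [set: R] (EFin \o (fun x => `|f x| `^ r)).
Proof.
move=> mf; apply/measurable_EFinP.
apply: (@measurableT_comp _ _ _ _ _ _ (@powR R ^~ r)) => //.
exact: measurableT_comp.
Qed.

Lemma LnormrP f (r c : R) : 0 < r -> 0 <= c ->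
  ('N[mu]_r%:E[EFin \o f] <= c%:E)%E <-> (\int[mu]_x (`|f x| `^ r)%:E <= (c `^ r)%:E)%E.
Proof.
move=> r0 c0; rewrite unlock.
have I0 : (0 <= \int[mu]_x (`|f x| `^ r)%:E)%E.
  by apply: integral_ge0 => x _; rewrite lee_fin powR_ge0.
have -> : (\int[mu]_x `|(EFin \o f) x| `^ r = \int[mu]_x (`|f x| `^ r)%:E)%E by [].
have ri0 : 0 <= r^-1 by rewrite invr_ge0 ltW.
split=> h.
  have : (((\int[mu]_x (`|f x| `^ r)%:E) `^ r^-1) `^ r <= c%:E `^ r)%E.
    by apply: gt0_ler_poweR h; rewrite ?in_itv/= ?leey ?andbT ?poweR_ge0 ?lee_fin// ltW.
  by rewrite -poweRrM mulVf ?gt_eqF// poweRe1// poweR_EFin.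
have : ((\int[mu]_x (`|f x| `^ r)%:E) `^ r^-1 <= (c `^ r)%:E `^ r^-1)%E.
  by apply: gt0_ler_poweR h; rewrite ?in_itv/= ?leey ?andbT ?lee_fin ?powR_ge0.
by rewrite poweR_EFin -powRrM mulfV ?gt_eqF// powRr1.
Qed.

Lemma le_Lnorm p f g : (1 <= p)%E -> measurable_fun [set: R] f -> measurable_fun [set: R] g ->
  {ae mu, forall x, `|f x| <= `|g x|} -> ('N[mu]_p[EFin \o f] <= 'N[mu]_p[EFin \o g])%E.
Proof.
case: p => [r||]//; last first.
  by move=> _ mf mg fg; rewrite unlock lebesgue_measure_setT_gt0 le_ess_sup.
rewrite lee_fin => r1 mf mg fg; rewrite unlock.
have r0 : 0 < r by exact: lt_le_trans r1.
have I0 h : (0 <= \int[mu]_x (`|h x| `^ r)%:E)%E.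
  by apply: integral_ge0 => x _; rewrite lee_fin powR_ge0.
apply: gt0_ler_poweR; rewrite ?in_itv/= ?leey ?andbT ?invr_ge0 ?(ltW r0) ?I0//.
apply: ae_ge0_le_integral => //; try (by move=> x _; rewrite lee_fin powR_ge0);
  try exact: measurable_powR_norm.
by apply: filterS fg => x fgx _; rewrite lee_fin ge0_ler_powR// ltW.
Qed.

Lemma LnormZ_fun p f (a : R) : (1 <= p)%E -> measurable_fun [set: R] f ->
  ('N[mu]_p[EFin \o (fun x => a * f x)%R] = `|a|%:E * 'N[mu]_p[EFin \o f])%E.
Proof.
case: p => [r||]//; last first.
  move=> _ mf; rewrite unlock lebesgue_measure_setT_gt0 -ess_supZl//; last first.
    exact: lebesgue_measure_setT_gt0.
  by congr ess_sup; apply/funext => x /=; rewrite normrM EFinM.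
rewrite lee_fin => r1 mf; rewrite unlock.
have r0 : 0 < r by exact: lt_le_trans r1.
have -> : (\int[mu]_x `|(EFin \o (fun x => a * f x)%R) x| `^ r)%E =
    ((`|a| `^ r)%:E * \int[mu]_x (`|f x| `^ r)%:E)%E.
  rewrite -ge0_integralZl_EFin ?powR_ge0//; last exact: measurable_powR_norm.
  by apply: eq_integral => x _ /=; rewrite normrM powRM// EFinM.
rewrite poweRM ?lee_fin ?powR_ge0//; last first.
  by apply: integral_ge0 => x _; rewrite lee_fin powR_ge0.
by rewrite poweR_EFin -powRrM mulfV ?gt_eqF// powRr1.
Qed.

Lemma le_limn_einf (u : (\bar R)^nat) (c : \bar R) : (forall n, c <= u n)%E -> (c <= limn_einf u)%E.
Proof.
move=> cu; rewrite limn_einf_lim; apply: lime_ge; first exact: is_cvg_einfs.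
by apply: nearW => n; apply: le_ereal_inf_tmp => _ [m _ <-].
Qed.

Lemma continuous_powR_gt0 (r x : R) : 0 < x -> {for x, continuous (@powR R ^~ r)}.
Proof.
move=> x0; apply: differentiable_continuous; apply/derivable1_diffP.
by apply: derivable_powR; rewrite in_itv/= x0.
Qed.

(** Fatou's lemma for finite [p]; for [+oo], countably many almost everywhere bounds hold together
    and pass to the pointwise limit. *)
Lemma Lnorm_lsc p (F : nat -> R -> R) f (c : R) : (1 <= p)%E -> 0 <= c ->
  (forall n, measurable_fun [set: R] (F n)) -> measurable_fun [set: R] f ->
  {ae mu, forall x, F n x @[n --> \oo] --> f x} ->
  (forall n, 'N[mu]_p[EFin \o F n] <= c%:E)%E -> ('N[mu]_p[EFin \o f] <= c%:E)%E.
Proof.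
move=> p1 c0 mF mf Ff Fc; case: p p1 Fc => [r||]//; last first.
  move=> _ Fc; apply/LnormyP.
  have {}Fc : {ae mu, forall x, forall n, `|F n x| <= c}.
    by apply/ae_foralln => n; apply/LnormyP.
  move: Ff Fc; apply: filterS2 => x Ffx Fc.
  have nFx : `|F n x| @[n --> \oo] --> `|f x| by exact: cvg_norm.
  rewrite -(cvg_lim _ nFx)//; apply: limr_le; last exact: nearW.
  by apply/cvg_ex; exists `|f x|.
rewrite lee_fin => r1 Fc; have r0 : 0 < r by exact: lt_le_trans r1.
apply/LnormrP => //; have {}Fc n := proj1 (LnormrP _ r0 c0) (Fc n).
have mG n : measurable_fun [set: R] (EFin \o (fun x => `|F n x| `^ r)).
  exact: measurable_powR_norm.
apply: (@le_trans _ _ (\int[mu]_x limn_einf (fun n => (`|F n x| `^ r)%:E))%E).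
  apply: ae_ge0_le_integral => //.
  - exact: measurable_powR_norm.
  - by move=> x _; apply: le_limn_einf => n; rewrite lee_fin powR_ge0.
  - apply: (@measurableT_comp _ _ _ _ _ _ oppe) => //.
    by apply: measurable_fun_limn_esup => n; apply: measurableT_comp => //; exact: mG.
  apply: filterS Ff => x Ffx _.
  (* At zeros of [f] nonnegativity suffices; elsewhere the power is continuous at the positive
     number [|f x|]. *)
  have [fx0|fx0] := eqVneq (f x) 0.
    rewrite fx0 normr0 powR0 ?gt_eqF//.
    by apply: le_limn_einf => n; rewrite lee_fin powR_ge0.
  suff h : (`|F n x| `^ r)%:E @[n --> \oo] --> (`|f x| `^ r)%:E.
    by rewrite (cvg_limn_einf_sup h).1.
  apply: cvg_EFin; first exact: nearW.
  apply: (@continuous_cvg _ _ _ _ _ (fun n => `|F n x|) (@powR R ^~ r)).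
    by apply: continuous_powR_gt0; rewrite normr_gt0.
  exact: cvg_norm.
apply: (@le_trans _ _ (limn_einf (fun n => \int[mu]_x (`|F n x| `^ r)%:E)%E)).
  by apply: fatou => // n x _; rewrite lee_fin powR_ge0.
rewrite limn_einf_lim; apply: lime_le; first exact: is_cvg_einfs.
apply: nearW => n; apply: le_trans (Fc n); apply: ereal_inf_lbound.
by exists n => //=.
Qed.

End Norm.

Lemma snorm_telescope (R : realType) (V : lmodType R) (S : set V) (N : V -> R)
    (a : nat -> V) (C : R) : seminorm_on S N -> (forall n, S (a n)) ->
  (forall n, N (a n.+1 - a n) <= C / 2 ^+ n) ->
  forall n k, N (a (n + k)%N - a n) <= 2 * C / 2 ^+ n.
Proof.
move=> sn Sa aC n k.
have C0 : 0 <= C.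
  have := aC 0; rewrite expr0 divr1; apply: le_trans; apply: (snorm_ge0 sn).
  exact: (domB sn).
have p0 m : 0 < 2 ^+ m :> R by rewrite exprn_gt0.
(* The induction needs the exact partial sum of the geometric series. *)
suff h : N (a (n + k)%N - a n) <= 2 * C / 2 ^+ n - 2 * C / 2 ^+ (n + k).
  by apply: le_trans h _; rewrite gerBl divr_ge0// ?mulr_ge0// ltW.
elim: k => [|k IH]; first by rewrite addn0 !subrr (snorm0 sn).
apply: le_trans (snorm_triangle sn (y := a (n + k)%N) _ _ _) _ => //.
rewrite addnS; have := aC (n + k)%N; have := IH.
have -> : 2 * C / 2 ^+ (n + k).+1 = C / 2 ^+ (n + k) by rewrite exprS; field; rewrite gt_eqF.
have -> : 2 * C / 2 ^+ (n + k) = 2 * (C / 2 ^+ (n + k)) by rewrite mulrA.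
lra.
Qed.

(** Makes the telescoping estimate available for real sequences. *)
Lemma normr_seminorm (R : realType) : seminorm_on [set: R^o] (fun x : R^o => `|x| : R).
Proof.
split=> // [x y _ _|a x _]; first exact: ler_normD.
exact: normrM.
Qed.

Lemma geometric_cvg (R : realType) (u : nat -> R) (C : R) :
  (forall n, `|u n.+1 - u n| <= C / 2 ^+ n) -> exists l : R, u n @[n --> \oo] --> l.
Proof.
move=> uC; have H := @snorm_telescope _ R^o _ _ u C (normr_seminorm R) (fun=> I) uC.
have C0 : 0 <= C by have := uC 0; rewrite expr0 divr1; exact: le_trans.
apply/cvg_ex; apply/cauchy_cvgP; apply: cauchy_exP => e e0.
pose n := (Num.trunc (2 * C / e)).+1.
exists (u n); exists n => // m /= nm; rewrite -ball_normE /ball_/= distrC.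
rewrite -(subnKC nm); apply: le_lt_trans (H _ _) _.
rewrite ltr_pdivrMr ?exprn_gt0// (mulrC e) -ltr_pdivrMr//.
apply: (@lt_trans _ _ n%:R); first exact: truncnS_gt.
by rewrite -natrX ltr_nat ltn_expl.
Qed.

(** * The seminorm of [X] and its completeness *)

Section XSpace.
Context (R : realType) (p : \bar R) (p1 : (1 <= p)%E).
Local Notation mu := (@lebesgue_measure R).
Implicit Types (f g : R -> R).

Lemma XN_ge0 f : (0 <= XN p f)%E.
Proof. by rewrite adde_ge0 ?Lnorm_ge0. Qed.

Lemma le_XN f g : measurable_fun [set: R] f -> measurable_fun [set: R] g ->
  {ae mu, forall x, `|f x| <= `|g x|} -> (XN p f <= XN p g)%E.
Proof. by move=> mf mg fg; apply: leeD; apply: le_Lnorm; rewrite ?leey. Qed.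

Lemma eq_XN f g : measurable_fun [set: R] f -> measurable_fun [set: R] g ->
  {ae mu, forall x, f x = g x} -> XN p f = XN p g.
Proof.
move=> mf mg fg; apply/eqP; rewrite eq_le !le_XN//; apply: filterS fg => x ->//.
Qed.

Lemma XND f g : measurable_fun [set: R] f -> measurable_fun [set: R] g ->
  (XN p (fun x => f x + g x)%R <= XN p f + XN p g)%E.
Proof.
move=> mf mg; rewrite /XN addeACA; by apply: leeD; apply: eminkowski => //; rewrite leey.
Qed.

Lemma XNZ f (a : R) : measurable_fun [set: R] f ->
  (XN p (fun x => a * f x)%R = `|a|%:E * XN p f)%E.
Proof.
by move=> mf; rewrite /XN !LnormZ_fun ?leey// muleDr// ge0_adde_def// inE Lnorm_ge0.
Qed.

Lemma XN0 : XN p (fun=> 0) = 0%E.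
Proof.
have p0 : p != 0%E by rewrite gt_eqF// (lt_le_trans _ p1)// lte01.
by rewrite /XN -[EFin \o _]/(cst 0%E) !Lnorm0// adde0.
Qed.

Lemma inX_fineK f : inX p f -> (fine (XN p f))%:E = XN p f.
Proof. by case=> _ fX; rewrite fineK// ge0_fin_numE// XN_ge0. Qed.

Lemma seminorm_X : seminorm_on (inX p : set (R -> R^o)) (fun f : R -> R^o => fine (XN p f)).
Proof.
have DX (f g : R -> R^o) : inX p f -> inX p g -> inX p (f + g).
  move=> [mf fX] [mg gX]; split; first exact: measurable_funD.
  by apply: le_lt_trans (XND mf mg) _; rewrite lte_add_pinfty.
have ZX (a : R) (f : R -> R^o) : inX p f -> inX p (a *: f).
  move=> [mf fX]; split; first exact: measurable_funM.
  by rewrite [ltLHS](XNZ a mf) lte_mul_pinfty.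
split=> //.
- by split; [exact: measurable_cst|rewrite XN0].
- by move=> f fX; rewrite fine_ge0// XN_ge0.
- move=> f g fX gX; rewrite -lee_fin EFinD !inX_fineK//; last exact: DX.
  by apply: XND; [case: fX|case: gX].
- move=> a f fX; have [mf _] := fX.
  by rewrite -[RHS]/(`|a| * _) [X in fine X](XNZ a mf) fineM// ge0_fin_numE ?XN_ge0//; case: fX.
Qed.

Lemma inX_ae f : inX p f -> {ae mu, forall x, `|f x| <= fine (XN p f)}.
Proof.
by move=> fX; apply/LnormyP; rewrite inX_fineK// /XN leeDr// Lnorm_ge0.
Qed.

Lemma fine_XN_eq0 f : inX p f -> fine (XN p f) = 0 <-> {ae mu, forall x, f x = 0}.
Proof.
move=> fX; split=> [f0|f0].
  by have := inX_ae fX; rewrite f0; apply: filterS => x; rewrite normr_le0 => /eqP.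
by case: fX => mf _; rewrite (@eq_XN _ (fun=> 0))// XN0.
Qed.

(** The factor 2 arises because each of the two norms is bounded by [c] separately; completeness
    does not feel this loss. *)
Lemma XN_lsc (F : nat -> R -> R) f (c : R) : 0 <= c ->
  (forall n, measurable_fun [set: R] (F n)) -> measurable_fun [set: R] f ->
  {ae mu, forall x, F n x @[n --> \oo] --> f x} ->
  (forall n, XN p (F n) <= c%:E)%E -> (XN p f <= (2 * c)%:E)%E.
Proof.
move=> c0 mF mf Ff Fc; rewrite mulrDl mul1r EFinD; apply: leeD.
  apply: (Lnorm_lsc p1 c0 mF mf Ff) => n; apply: le_trans (Fc n).
  by rewrite leeDl// Lnorm_ge0.
apply: (Lnorm_lsc _ c0 mF mf Ff) => [|n]; first by rewrite leey.
by apply: le_trans (Fc n); rewrite leeDr// Lnorm_ge0.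
Qed.

(** The sup norm controls increments at almost every point, so the sequence converges geometrically
    there without extracting a subsequence. Lower semicontinuity along [a n - a (k + n)] then turns
    the pointwise limit into a limit in [X]. *)
Lemma complete_X : complete_on (inX p : set (R -> R^o)) (fun f : R -> R^o => fine (XN p f)).
Proof.
move=> a C Xa aC; have sn := seminorm_X.
have XB n m : inX p (a n - a m) by exact: (domB sn).
have ma n : measurable_fun [set: R] (a n) by case: (Xa n).
have C0 : 0 <= C.
  have := aC 0; rewrite expr0 divr1; apply: le_trans; exact: (snorm_ge0 sn).
(* An upper limit, so that [y] is measurable despite divergence on a null set. *)
pose y (x : R) : R := fine (limn_esup (fun n => (a n x : R)%:E)).
have my : measurable_fun [set: R] y.
  apply: (@measurableT_comp _ _ _ _ _ _ fine) => //.
  by apply: measurable_fun_limn_esup => n; exact/measurable_EFinP.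
have ay : {ae mu, forall x, (a n x : R) @[n --> \oo] --> y x}.
  have : {ae mu, forall x, forall n, `|(a n.+1 x - a n x : R)| <= C / 2 ^+ n}.
    apply/ae_foralln => n; apply: filterS (inX_ae (XB n.+1 n)) => x h.
    exact: le_trans h (aC n).
  apply: filterS => x /geometric_cvg[l xl].
  have el : (a n x : R)%:E @[n --> \oo] --> l%:E by apply: cvg_EFin => //; exact: nearW.
  by rewrite /y (cvg_limn_einf_sup el).2.
have key n : inX p (a n - y : R -> R^o) /\ fine (XN p (a n - y)) <= 2 * (2 * C / 2 ^+ n).
  have m1 : measurable_fun [set: R] (a n - y) by exact: measurable_funB.
  have c0 : 0 <= 2 * C / 2 ^+ n by rewrite divr_ge0 ?mulr_ge0// exprn_ge0.
  have h : (XN p (a n - y)%R <= (2 * (2 * C / 2 ^+ n))%:E)%E.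
    apply: (@XN_lsc (fun k => a n - a (k + n)%N)) => //.
    - by move=> k; exact: measurable_funB.
    - apply: filterS ay => x ayx; apply: cvgB; first exact: cvg_cst.
      by move: ayx; rewrite -(cvg_shiftn n).
    - move=> k; rewrite -inX_fineK//; rewrite lee_fin (snormBC sn)//.
      by rewrite addnC; exact: (snorm_telescope sn Xa aC).
  have X : inX p (a n - y : R -> R^o) by split=> //; exact: le_lt_trans h (ltry _).
  by split=> //; rewrite -lee_fin inX_fineK.
have Xy : inX p (y : R -> R^o).
  rewrite -(subKr (a 0) (y : R -> R^o)); apply: (domB sn) => //; exact: (key 0).1.
exists y; split=> // e e0.
pose n0 := (Num.trunc (4 * C / e)).+1.
exists n0 => n nn; apply: le_trans (key n).2 _.
rewrite (mulrA 2) ler_pdivrMr ?exprn_gt0// (mulrC e) -ler_pdivrMr//.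
have -> : 2 * (2 * C) = 4 * C by ring.
apply/ltW/(@lt_trans _ _ n0%:R); first exact: truncnS_gt.
by rewrite -natrX ltr_nat; apply: leq_ltn_trans nn _; rewrite ltn_expl.
Qed.

End XSpace.

(** * Convolution with an integrable kernel *)

(** The graph of the power [r] lies above its tangent at [c], rearranged without subtraction. It is
    Young's inequality for [r] and [r / (r - 1)]; at [r = 1] there is no finite conjugate
    exponent. *)
Lemma powR_tangent (R : realType) (r b c : R) : 1 <= r -> 0 <= b -> 0 <= c ->
  r * (b * c `^ (r - 1)) <= b `^ r + (r - 1) * c `^ r.
Proof.
rewrite le_eqVlt => /predU1P[<-|r1] b0 c0.
  by rewrite subrr powRr0 powRr1// mul0r addr0 !mulr1 mul1r.
have r0 : 0 < r by lra.
have r10 : 0 < r - 1 by lra.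
have q0 : 0 < r / (r - 1) by rewrite divr_gt0.
have pq : r^-1 + (r / (r - 1))^-1 = 1.
  by rewrite invf_div; field; rewrite gt_eqF//= gt_eqF.
have := conjugate_powR b0 (powR_ge0 c (r - 1)) r0 q0 pq.
rewrite -powRrM (_ : (r - 1) * (r / (r - 1)) = r); last by field; rewrite gt_eqF.
move/(ler_wpM2l (ltW r0))/le_trans; apply.
rewrite invf_div mulrDr [r * (b `^ r / r)]mulrC divfK ?gt_eqF// lerD2l.
by rewrite [r * _]mulrC -mulrA divfK ?gt_eqF// mulrC.
Qed.

Section Translation.
Context (R : realType).
Local Notation mu := (@lebesgue_measure R).

Let measurable_subr_cst (a : R) : measurable_fun [set: R] (fun y : R => y - a).
Proof. exact: measurable_funB. Qed.

(** By uniqueness of Lebesgue measure it is enough to compare lengths of half-open intervals. *)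
Lemma lebesgue_measure_shift (a : R) (A : set R) : measurable A ->
  pushforward mu ((fun y => y - a) : _ -> measurableTypeR R) A = mu A.
Proof.
move=> mA; apply/esym/lebesgue_measure_unique => //=.
  exact: measurable_subr_cst.
move=> _ _ [[b c]] _ <-.
rewrite /pushforward/=.
have -> : (fun y => y - a) @^-1` `]b, c]%classic = `](b + a), (c + a)]%classic.
  by apply/funext => y; rewrite /preimage/mkset/= !in_itv/= ltrBrDr lerBlDr.
rewrite !lebesgue_measure_itv/= !lte_fin ltrD2r; case: ifP => // _.
by rewrite -!EFinB; congr EFin; ring.
Qed.

Lemma ge0_integral_shift (f : R -> \bar R) (a : R) :
  measurable_fun [set: R] f -> (forall y, 0 <= f y)%E ->
  (\int[mu]_y f (y - a)%R = \int[mu]_y f y)%E.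
Proof.
move=> mf f0.
have ms : measurable_fun [set: measurableTypeR R]
    ((fun y => y - a) : measurableTypeR R -> measurableTypeR R).
  exact: measurable_subr_cst.
have := @ge0_integral_pushforward _ _ _ _ R _ ms mu setT f measurableT mf (fun _ _ => f0 _).
rewrite preimage_setT => <-.
by apply: eq_measure_integral => A mA _; exact: lebesgue_measure_shift.
Qed.

Lemma ge0_integral_reflect (f : R -> \bar R) (b : R) :
  measurable_fun [set: R] f -> (forall y, 0 <= f y)%E ->
  (\int[mu]_x f (b - x)%R = \int[mu]_x f x)%E.
Proof.
move=> mf f0.
have mN : measurable_fun [set: measurableTypeR R]
    (-%R : measurableTypeR R -> measurableTypeR R) by exact: oppr_measurable.
have mfN : measurable_fun [set: R] (fun x => f (- x)) by exact: measurableT_comp.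
have := @ge0_integral_pushforward _ _ _ _ R _ mN mu setT f measurableT mf (fun _ _ => f0 _).
rewrite preimage_setT => pushE.
rewrite -[RHS](_ :
  (\int[pushforward mu (-%R : measurableTypeR R -> measurableTypeR R)]_y f y = _)%E).
  rewrite pushE -(ge0_integral_shift b mfN)//.
  by apply: eq_integral => x _; rewrite opprB.
by apply: eq_measure_integral => A mA _; exact: lebesgue_measureN.
Qed.

End Translation.

(** * Young's inequality for an integrable kernel *)

Section Kernel.
Context (R : realType) (alpha : R -> R).
Local Notation mu := (@lebesgue_measure R).
Context (ia : mu.-integrable [set: R] (EFin \o alpha)).

(* One is added so that [kmass] can be divided by. *)
Definition kmass : R := fine (\int[mu]_x `|(alpha x)%:E|)%E + 1.

Lemma measurable_kernel : measurable_fun [set: R] alpha.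
Proof. by apply/measurable_EFinP; case/integrableP: ia. Qed.

Lemma kmass_gt0 : 0 < kmass.
Proof. by rewrite ltr_wpDl// fine_ge0// integral_ge0. Qed.

Lemma integral_kernel_le : (\int[mu]_x `|alpha x|%:E <= kmass%:E)%E.
Proof.
have /integrableP[_ h] := ia.
have h0 : (0 <= \int[mu]_x `|(alpha x)%:E|)%E by exact: integral_ge0.
rewrite /kmass EFinD fineK ?ge0_fin_numE//.
by rewrite -[leLHS]adde0 leeD2l// lee_fin.
Qed.

Lemma measurable_abs_kernel : measurable_fun [set: R] (EFin \o (fun x => `|alpha x|)).
Proof. by apply/measurable_EFinP; apply: measurableT_comp => //; exact: measurable_kernel. Qed.

Lemma integral_kernel_row (x : R) : (\int[mu]_y `|alpha (y - x)|%:E <= kmass%:E)%E.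
Proof.
apply: le_trans integral_kernel_le.
by rewrite (ge0_integral_shift x measurable_abs_kernel)// => y; rewrite lee_fin.
Qed.

(** Rows bound a convolution pointwise; columns appear once Tonelli's theorem has exchanged the
    integrals. *)
Lemma integral_kernel_col (y : R) : (\int[mu]_x `|alpha (y - x)|%:E <= kmass%:E)%E.
Proof.
apply: le_trans integral_kernel_le.
by rewrite (ge0_integral_reflect y measurable_abs_kernel)// => x; rewrite lee_fin.
Qed.

(** Valued in [\bar R] so that Tonelli's theorem applies before finiteness is known; meant for
    nonnegative [h]. *)
Definition conv (h : R -> R) (x : R) : \bar R := (\int[mu]_y (`|alpha (y - x)| * h y)%:E)%E.

Lemma measurable_conv_integrand (h : R -> R) : measurable_fun [set: R] h ->
  measurable_fun [set: R * R] (EFin \o (fun z => `|alpha (z.2 - z.1)| * h z.2)).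
Proof.
move=> mh; apply/measurable_EFinP; apply: measurable_funM; last exact: measurableT_comp.
apply: measurableT_comp => //; apply: measurableT_comp; first exact: measurable_kernel.
exact: measurable_funB.
Qed.

Lemma measurable_conv (h : R -> R) : measurable_fun [set: R] h -> (forall y, 0 <= h y) ->
  measurable_fun [set: R] (conv h).
Proof.
move=> mh h0.
have f0 (z : R * R) : (0 <= (EFin \o (fun z => `|alpha (z.2 - z.1)| * h z.2)%R) z)%E.
  by rewrite lee_fin mulr_ge0.
exact: (measurable_fun_fubini_tonelli_F (m2 := mu) _ (measurable_conv_integrand mh) f0).
Qed.

Lemma conv_ge0 (h : R -> R) x : (forall y, 0 <= h y) -> (0 <= conv h x)%E.
Proof. by move=> h0; apply: integral_ge0 => y _; rewrite lee_fin mulr_ge0. Qed.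

Lemma measurable_conv_row (h : R -> R) x : measurable_fun [set: R] h ->
  measurable_fun [set: R] (EFin \o (fun y => `|alpha (y - x)| * h y)).
Proof.
move=> mh; apply/measurable_EFinP; apply: measurable_funM => //.
apply: measurableT_comp => //; apply: measurableT_comp; first exact: measurable_kernel.
exact: measurable_funB.
Qed.

Lemma conv_cst x (c : R) : 0 <= c -> (conv (fun=> c) x <= (kmass * c)%:E)%E.
Proof.
move=> c0; rewrite /conv; under eq_integral do rewrite mulrC EFinM.
rewrite ge0_integralZl_EFin//; last first.
  have := measurable_conv_row x (measurable_cst (1 : R)).
  by congr measurable_fun; apply/funext => y /=; rewrite mulr1.
by rewrite mulrC EFinM lee_wpmul2l// integral_kernel_row.
Qed.

Lemma le_conv (h k : R -> R) x : measurable_fun [set: R] h -> measurable_fun [set: R] k ->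
  (forall y, 0 <= h y) -> (forall y, 0 <= k y) ->
  {ae mu, forall y, h y <= k y} -> (conv h x <= conv k x)%E.
Proof.
move=> mh mk h0 k0 hk; apply: ae_ge0_le_integral => //.
- by move=> y _; rewrite lee_fin mulr_ge0.
- exact: measurable_conv_row.
- by move=> y _; rewrite lee_fin mulr_ge0.
- exact: measurable_conv_row.
- by apply: filterS hk => y hky _; rewrite lee_fin ler_wpM2l.
Qed.

Lemma convD (h k : R -> R) x : measurable_fun [set: R] h -> measurable_fun [set: R] k ->
  (forall y, 0 <= h y) -> (forall y, 0 <= k y) ->
  conv (fun y => h y + k y) x = (conv h x + conv k x)%E.
Proof.
move=> mh mk h0 k0; rewrite /conv -ge0_integralD//.
- by apply: eq_integral => y _; rewrite -EFinD mulrDr.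
- by move=> y _; rewrite lee_fin mulr_ge0.
- exact: measurable_conv_row.
- by move=> y _; rewrite lee_fin mulr_ge0.
- exact: measurable_conv_row.
Qed.

Lemma convZ (h : R -> R) (c x : R) : 0 <= c -> measurable_fun [set: R] h ->
  (forall y, 0 <= h y) -> conv (fun y => c * h y) x = (c%:E * conv h x)%E.
Proof.
move=> c0 mh h0; rewrite /conv -ge0_integralZl_EFin//.
- by apply: eq_integral => y _; rewrite -EFinM mulrCA.
- by move=> y _; rewrite lee_fin mulr_ge0.
- exact: measurable_conv_row.
Qed.

Lemma conv_le_sup (h : R -> R) (H x : R) : measurable_fun [set: R] h -> (forall y, 0 <= h y) ->
  {ae mu, forall y, h y <= H} -> 0 <= H -> (conv h x <= (kmass * H)%:E)%E.
Proof.
move=> mh h0 hH H0; apply: le_trans (conv_cst x H0).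
by apply: le_conv => //; exact: measurable_cst.
Qed.

(* Jensen's inequality for the measure [alpha (y - x) dy], obtained by integrating
   the tangent line of the power function at [conv h x / kmass]. *)
Lemma conv_jensen (h : R -> R) (H r x : R) : 1 <= r ->
  measurable_fun [set: R] h -> (forall y, 0 <= h y) ->
  {ae mu, forall y, h y <= H} -> 0 <= H ->
  ((fine (conv h x) `^ r)%:E <= (kmass `^ (r - 1))%:E * conv (fun y => h y `^ r)%R x)%E.
Proof.
move=> r1 mh h0 hH H0; have r0 : 0 < r by lra.
have A0 := kmass_gt0.
have c0 := conv_ge0 x h0; have cH := conv_le_sup x mh h0 hH H0.
set B := fine (conv h x).
have BE : conv h x = B%:E by rewrite fineK// ge0_fin_numE// (le_lt_trans cH)// ltry.
have B0 : 0 <= B by exact: fine_ge0.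
pose c := B / kmass.
have cc0 : 0 <= c by rewrite divr_ge0// ltW.
have BAc : B = kmass * c by rewrite mulrC divfK// gt_eqF.
have mp : measurable_fun [set: R] (fun y => h y `^ r).
  exact: (@measurableT_comp _ _ _ _ _ _ (@powR R ^~ r)).
have hp0 y : 0 <= h y `^ r by exact: powR_ge0.
have I0 := conv_ge0 x hp0.
have tangent : ((r * c `^ (r - 1) * B)%:E <=
    conv (fun y => h y `^ r)%R x + (kmass * ((r - 1) * c `^ r))%:E)%E.
  have d0 : 0 <= r * c `^ (r - 1) by rewrite mulr_ge0 ?powR_ge0// ltW.
  have e0 : 0 <= (r - 1) * c `^ r by rewrite mulr_ge0 ?powR_ge0//; lra.
  rewrite EFinM -BE -convZ//.
  apply: le_trans (leeD2l _ (conv_cst x e0)).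
  rewrite -convD//; apply: le_conv => //.
  - exact: measurable_funM.
  - exact: measurable_funD.
  - by move=> y; rewrite mulr_ge0.
  - by move=> y; rewrite addr_ge0.
  - apply: nearW => y; have := powR_tangent r1 (h0 y) cc0; lra.
have cr : c * c `^ (r - 1) = c `^ r by exact: mulr_powRB1.
(* Since [B = kmass * c], the left side of [tangent] is [r * kmass * c ^ r], and subtracting its
   constant term leaves [kmass * c ^ r]. That [kmass] exceeds the true mass is harmless, because the
   constant term is nonnegative. *)
have -> : B `^ r = kmass `^ (r - 1) * (kmass * c `^ r).
  by rewrite mulrA [_ * kmass]mulrC mulr_powRB1// ?ltW// -powRM// ?ltW// -BAc.
rewrite EFinM lee_wpmul2l ?lee_fin ?powR_ge0//.
case: (conv (fun y => h y `^ r)%R x) I0 tangent => [I| |]//= I0; last by move=> _; exact: leey.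
rewrite -EFinD !lee_fin -cr BAc; move: (c `^ (r - 1)) => X; lra.
Qed.

(** Jensen's inequality contributes [kmass ^ (r - 1)], and after Tonelli's theorem the column mass
    contributes the last factor [kmass]. *)
Lemma conv_Lr (h : R -> R) (H r : R) : 1 <= r ->
  measurable_fun [set: R] h -> (forall y, 0 <= h y) ->
  {ae mu, forall y, h y <= H} -> 0 <= H ->
  (\int[mu]_x (fine (conv h x) `^ r)%:E <= (kmass `^ r)%:E * \int[mu]_x (h x `^ r)%:E)%E.
Proof.
move=> r1 mh h0 hH H0; have r0 : 0 < r by lra.
have A0 := kmass_gt0.
have mp : measurable_fun [set: R] (fun y => h y `^ r).
  exact: (@measurableT_comp _ _ _ _ _ _ (@powR R ^~ r)).
have hp0 y : 0 <= h y `^ r by exact: powR_ge0.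
have mc := measurable_conv mp hp0.
apply: (@le_trans _ _ (\int[mu]_x ((kmass `^ (r - 1))%:E * conv (fun y => h y `^ r)%R x))%E).
  apply: ge0_le_integral => //.
  - by move=> x _; rewrite lee_fin powR_ge0.
  - apply/measurable_EFinP; apply: (@measurableT_comp _ _ _ _ _ _ (@powR R ^~ r)) => //.
    apply: (@measurableT_comp _ _ _ _ _ _ fine) => //; exact: measurable_conv.
  - exact: measurable_funeM.
  - by move=> x _; exact: (conv_jensen _ r1 mh h0 hH).
rewrite ge0_integralZl_EFin ?powR_ge0//; last by move=> x _; exact: conv_ge0.
have f0 (z : R * R) : (0 <= (EFin \o (fun z => `|alpha (z.2 - z.1)| * h z.2 `^ r)%R) z)%E.
  by rewrite lee_fin mulr_ge0.
rewrite (fubini_tonelli (m1 := mu) (m2 := mu) _ (measurable_conv_integrand mp) f0).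
have -> : kmass `^ r = kmass `^ (r - 1) * kmass.
  by rewrite mulrC mulr_powRB1// ltW.
rewrite EFinM -muleA lee_wpmul2l ?lee_fin ?powR_ge0//.
rewrite -ge0_integralZl_EFin ?(ltW A0)//; [|by move=> x _; rewrite lee_fin|exact/measurable_EFinP].
apply: ge0_le_integral.
- exact: measurableT.
- by move=> y _; apply: integral_ge0 => x _; rewrite lee_fin mulr_ge0.
- exact: (measurable_fun_fubini_tonelli_G (m1 := mu) _ (measurable_conv_integrand mp) f0).
- by apply: measurable_funeM; exact/measurable_EFinP.
- move=> y _ /=; under eq_integral do rewrite mulrC EFinM.
  rewrite ge0_integralZl_EFin//; last first.
    apply/measurable_EFinP; apply: measurableT_comp => //.
    by apply: measurableT_comp; [exact: measurable_kernel|exact: measurable_funB].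
  rewrite muleC; apply: lee_wpmul2r; [by rewrite lee_fin|exact: integral_kernel_col].
Qed.

End Kernel.

(** * The nonlocal operator *)

(** Mean value theorem, with the maximum of the absolute derivative on [[- K, K]] as constant. *)
Lemma lipschitz_on_ball (R : realType) (w : R -> R) : (forall x, derivable w x 1) ->
  continuous (derive1 w) -> forall K : R, exists2 L : R, 0 <= L &
    forall a b, `|a| <= K -> `|b| <= K -> `|w a - w b| <= L * `|a - b|.
Proof.
move=> dw cw K; have [K0|K0] := ltP K 0.
  by exists 0 => // a b aK; have := le_lt_trans aK K0; rewrite normr_lt0.
have cn : {within `[- K, K], continuous (fun x => `|derive1 w x|)}.
  by apply: continuous_subspaceT => x; apply: cvg_norm; exact: cw.
have [|c cK cmax] := EVT_max _ cn; first lra.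
exists `|derive1 w c| => //.
have main a b : a <= b -> `|a| <= K -> `|b| <= K -> `|w b - w a| <= `|derive1 w c| * `|b - a|.
  move=> ab aK bK.
  have [||d dab ->] := @MVT_segment R w (derive1 w) a b ab.
  - by move=> x _; rewrite derive1E; apply: DeriveDef.
  - apply: continuous_subspaceT => x; apply: differentiable_continuous.
    exact/derivable1_diffP.
  rewrite normrM ler_wpM2r//; apply: cmax; move: dab; rewrite !in_itv/=.
  by move: aK bK; rewrite !ler_norml; lra.
move=> a b aK bK; have [ab|/ltW ba] := leP a b; last exact: main.
by rewrite distrC (distrC a); exact: main.
Qed.

Section Rhs.
Context (R : realType) (p : \bar R) (p1 : (1 <= p)%E) (alpha w : R -> R).
Local Notation mu := (@lebesgue_measure R).
Context (ia : mu.-integrable [set: R] (EFin \o alpha)).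
Context (mw : measurable_fun [set: R] w) (w0 : w 0 = 0).
Local Notation A := (kmass alpha).

(** The real-valued form of [conv] on absolute values; [fine] loses nothing for essentially bounded
    [h], by [kconvE]. *)
Definition kconv (h : R -> R) (x : R) : R := fine (conv alpha (fun y => `|h y|) x).

Lemma measurable_kconv (h : R -> R) : measurable_fun [set: R] h ->
  measurable_fun [set: R] (kconv h).
Proof.
move=> mh; apply: (@measurableT_comp _ _ _ _ _ _ fine) => //.
by apply: (measurable_conv ia) => //; exact: measurableT_comp.
Qed.

Lemma kconv_ge0 (h : R -> R) x : 0 <= kconv h x.
Proof. by apply: fine_ge0; exact: conv_ge0. Qed.

Lemma kconvE (h : R -> R) (H x : R) : measurable_fun [set: R] h ->
  {ae mu, forall y, `|h y| <= H} -> 0 <= H ->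
  conv alpha (fun y => `|h y|) x = (kconv h x)%:E.
Proof.
move=> mh hH H0; have mn : measurable_fun [set: R] (fun y => `|h y|) by exact: measurableT_comp.
rewrite /kconv fineK// ge0_fin_numE ?conv_ge0//.
by apply: le_lt_trans (conv_le_sup ia x mn _ hH H0) _; rewrite ?ltry.
Qed.

(** The essential bound [H] does not enter the estimate; it makes the convolution finite at every
    point, also for finite [q]. *)
Lemma kconv_Lnorm (q : \bar R) (h : R -> R) (H : R) : (1 <= q)%E ->
  measurable_fun [set: R] h -> {ae mu, forall y, `|h y| <= H} -> 0 <= H ->
  ('N[mu]_q[EFin \o h] < +oo)%E ->
  ('N[mu]_q[EFin \o kconv h] <= A%:E * 'N[mu]_q[EFin \o h])%E.
Proof.
move=> q1 mh hH H0 hfin; have A0 := kmass_gt0 alpha.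
have mn : measurable_fun [set: R] (fun y => `|h y|) by exact: measurableT_comp.
have n0 y : 0 <= `|h y| by [].
have [n nn0 hE] : exists2 n : R, 0 <= n & ('N[mu]_q[EFin \o h] = n%:E)%E.
  exists (fine 'N[mu]_q[EFin \o h]%E); first by rewrite fine_ge0// Lnorm_ge0.
  by rewrite fineK// ge0_fin_numE// Lnorm_ge0.
rewrite hE -EFinM; case: q q1 hfin hE => [r||]//; last first.
  move=> _ _ hE; apply/LnormyP; apply: nearW => x.
  rewrite ger0_norm ?kconv_ge0// -lee_fin -(kconvE x mh hH H0).
  apply: conv_le_sup => //.
  by apply/LnormyP; rewrite hE.
rewrite lee_fin => r1 hfin hE; have r0 : 0 < r by lra.
apply/LnormrP => //; first by rewrite mulr_ge0// ltW.
have hn : ('N[mu]_r%:E[EFin \o h] <= n%:E)%E by rewrite hE.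
move/(LnormrP _ r0 nn0) : hn => hn.
under eq_integral do rewrite ger0_norm ?kconv_ge0//.
apply: le_trans (conv_Lr ia r1 mn n0 hH H0) _.
by rewrite powRM ?(ltW A0)// EFinM lee_wpmul2l ?lee_fin ?powR_ge0.
Qed.

Lemma XN_kconv (h : R -> R) : inX p h -> (XN p (kconv h) <= A%:E * XN p h)%E.
Proof.
move=> hX; have [mh hfin] := hX; have hH := inX_ae hX.
have H0 : 0 <= fine (XN p h) by rewrite fine_ge0// XN_ge0.
rewrite /XN muleDr//; last by rewrite ge0_adde_def// inE Lnorm_ge0.
apply: leeD; apply: (kconv_Lnorm _ mh hH H0) => //; rewrite ?leey//.
  by apply: le_lt_trans hfin; rewrite leeDl// Lnorm_ge0.
by apply: le_lt_trans hfin; rewrite leeDr// Lnorm_ge0.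
Qed.

(** Tonelli's theorem applies to the positive and negative parts separately, so measurability holds
    for every measurable [v], integrable integrand or not. *)
Lemma measurable_rhs (v : R -> R) : measurable_fun [set: R] v ->
  measurable_fun [set: R] (rhs alpha w v).
Proof.
move=> mv; apply: (@measurableT_comp _ _ _ _ _ _ fine) => //.
pose F : R * R -> \bar R := EFin \o (fun z => alpha (z.2 - z.1) * w (v z.2 - v z.1)).
have mF : measurable_fun [set: R * R] F.
  apply/measurable_EFinP; apply: measurable_funM.
    by apply: measurableT_comp; [exact: measurable_kernel|exact: measurable_funB].
  apply: measurableT_comp => //.
  by apply: measurable_funB; exact: measurableT_comp.
rewrite [X in measurable_fun _ X](_ : _ =
  (fun x => (\int[mu]_y F^\+ (x, y) - \int[mu]_y F^\- (x, y))%E)); last first.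
  apply/funext => x; rewrite integralE.
  by congr (_ - _)%E; apply: eq_integral => y _; rewrite ?(funeposE, funenegE).
apply: emeasurable_funB.
- exact: (measurable_fun_fubini_tonelli_F (m2 := mu) _ (measurable_funepos mF) (funepos_ge0 _)).
- exact: (measurable_fun_fubini_tonelli_F (m2 := mu) _ (measurable_funeneg mF) (funeneg_ge0 _)).
Qed.

Lemma measurable_rhs_integrand (f : R -> R) (x : R) : measurable_fun [set: R] f ->
  measurable_fun [set: R] (fun y => alpha (y - x) * w (f y - f x)).
Proof.
move=> mf; apply: measurable_funM.
  by apply: measurableT_comp; [exact: measurable_kernel|exact: measurable_funB].
by apply: measurableT_comp => //; exact: measurable_funB.
Qed.

Context (M L : R) (M0 : 0 <= M) (L0 : 0 <= L).
Context (wL : forall a b, `|a| <= 2 * M -> `|b| <= 2 * M -> `|w a - w b| <= L * `|a - b|).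

(** The arguments of [w] are differences of values bounded by [M], whence the radius [2 * M] in
    [wL]. *)
Let dist2 (a b : R) : `|a| <= M -> `|b| <= M -> `|a - b| <= 2 * M.
Proof. by move=> aM bM; apply: le_trans (ler_normB _ _) _; lra. Qed.

Lemma integrable_rhs (f : R -> R) (x : R) : measurable_fun [set: R] f ->
  {ae mu, forall y, `|f y| <= M} -> `|f x| <= M ->
  mu.-integrable [set: R] (EFin \o (fun y => alpha (y - x) * w (f y - f x))).
Proof.
move=> mf fM fxM; apply/integrableP; split.
  by apply/measurable_EFinP; exact: measurable_rhs_integrand.
have LM0 : 0 <= L * (2 * M) by rewrite !mulr_ge0.
apply: (@le_lt_trans _ _ (conv alpha (fun=> L * (2 * M)) x)); last first.
  by apply: le_lt_trans (conv_cst ia x LM0) _; rewrite ltry.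
apply: ae_ge0_le_integral.
- exact: measurableT.
- by [].
- apply: measurableT_comp => //.
  by apply/measurable_EFinP; exact: measurable_rhs_integrand.
- by move=> y _; rewrite lee_fin mulr_ge0.
- by apply: (measurable_conv_row ia); exact: measurable_cst.
apply: filterS fM => y fyM _; rewrite /= lee_fin normrM ler_wpM2l//.
have d2 := dist2 fyM fxM.
have := wL d2 (_ : `|0| <= 2 * M); rewrite w0 !subr0 normr0 => /(_ _)/le_trans; apply.
  by rewrite mulr_ge0.
by rewrite ler_wpM2l.
Qed.

(** The almost everywhere bounds serve twice: at [x], which must avoid the null set, and at [y]
    under the integral. With [h = f - g], the increments differ by [h y - h x]; the first term gives
    the convolution and the second the mass [A]. *)
Lemma rhs_sub_le (f g : R -> R) : measurable_fun [set: R] f -> measurable_fun [set: R] g ->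
  {ae mu, forall y, `|f y| <= M} -> {ae mu, forall y, `|g y| <= M} ->
  {ae mu, forall x, `|rhs alpha w f x - rhs alpha w g x| <=
     L * (kconv (fun y => f y - g y) x + A * `|f x - g x|)}.
Proof.
move=> mf mg fM gM; move: (fM) (gM); apply: filterS2 => x fxM gxM.
have If := integrable_rhs mf fM fxM; have Ig := integrable_rhs mg gM gxM.
rewrite /rhs -RintegralB//.
have Id : mu.-integrable [set: R]
   (EFin \o (fun y => alpha (y - x) * w (f y - f x) - alpha (y - x) * w (g y - g x))).
  exact: (integrableB measurableT If Ig).
apply: le_trans (le_normr_Rintegral measurableT Id) _.
pose h y := f y - g y.
have mh : measurable_fun [set: R] h by exact: measurable_funB.
have hM : {ae mu, forall y, `|h y| <= 2 * M}.
  by move: fM gM; apply: filterS2 => y; exact: dist2.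
have M20 : 0 <= 2 * M by rewrite mulr_ge0.
have mn : measurable_fun [set: R] (fun y => `|h y|) by exact: measurableT_comp.
have kE := kconvE x mh hM M20.
rewrite -lee_fin /Rintegral fineK; last first.
  by rewrite ge0_fin_numE; [case/integrableP: Id|exact: integral_ge0].
apply: (@le_trans _ _ (conv alpha (fun y => L * (`|h y| + `|h x|)) x)).
  apply: ae_ge0_le_integral.
  - exact: measurableT.
  - by [].
  - apply/measurable_EFinP; apply: measurableT_comp => //.
    by apply: measurable_funB; exact: measurable_rhs_integrand.
  - by move=> y _; rewrite lee_fin !mulr_ge0// addr_ge0.
  - by apply: (measurable_conv_row ia); apply: measurable_funM => //; exact: measurable_funD.
  move: fM gM; apply: filterS2 => y fyM gyM _.
  rewrite lee_fin -mulrBr normrM ler_wpM2l//.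
  apply: le_trans (wL (dist2 fyM fxM) (dist2 gyM gxM)) _.
  rewrite ler_wpM2l// (_ : f y - f x - (g y - g x) = h y - h x); last by rewrite /h; ring.
  exact: ler_normB.
rewrite (convZ ia)//; last exact: measurable_funD.
rewrite EFinM lee_wpmul2l ?lee_fin// (convD ia)// kE EFinD leeD2l//.
exact: conv_cst.
Qed.

(** In [2 * L * A], one [A] comes from Young's inequality and the other from the local term. *)
Lemma XN_rhs_sub (f g : R -> R) : inX p f -> inX p g ->
  fine (XN p f) <= M -> fine (XN p g) <= M ->
  inX p (fun x => rhs alpha w f x - rhs alpha w g x) /\
  (XN p (fun x => rhs alpha w f x - rhs alpha w g x)%R <=
     (2 * L * A)%:E * XN p (fun x => f x - g x)%R)%E.
Proof.
move=> fX gX fM gM; have [mf _] := fX; have [mg _] := gX.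
have A0 := kmass_gt0 alpha.
have {}fM : {ae mu, forall y, `|f y| <= M}.
  by apply: filterS (inX_ae fX) => y h; exact: le_trans h fM.
have {}gM : {ae mu, forall y, `|g y| <= M}.
  by apply: filterS (inX_ae gX) => y h; exact: le_trans h gM.
pose h y := f y - g y.
have hX : inX p h by exact: (domB (seminorm_X p1) fX gX).
have mh : measurable_fun [set: R] h by exact: measurable_funB.
have mn : measurable_fun [set: R] (fun y => `|h y|) by exact: measurableT_comp.
have mk := measurable_kconv mh.
have mr : measurable_fun [set: R] (fun x => rhs alpha w f x - rhs alpha w g x).
  by apply: measurable_funB; exact: measurable_rhs.
suff bound : (XN p (fun x => rhs alpha w f x - rhs alpha w g x)%R <=
     (2 * L * A)%:E * XN p h)%E.
  split=> //; split=> //; apply: le_lt_trans bound _.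
  by rewrite lte_mul_pinfty// ?lee_fin ?mulr_ge0 ?(ltW A0)//; case: hX.
have nE : XN p (fun y => `|h y|) = XN p h.
  apply/eqP; rewrite eq_le !le_XN//; apply: nearW => x; by rewrite normr_id.
apply: (@le_trans _ _ (XN p (fun x => L * (kconv h x + A * `|h x|))%R)).
  apply: le_XN => //.
    apply: measurable_funM => //; apply: measurable_funD => //.
    exact: measurable_funM.
  apply: filterS (rhs_sub_le mf mg fM gM) => x /le_trans; apply.
  exact: ler_norm.
rewrite XNZ ?ger0_norm//; last by apply: measurable_funD => //; exact: measurable_funM.
apply: le_trans (lee_wpmul2l _ (XND p1 _ _)) _; rewrite ?lee_fin//; [exact: measurable_funM|].
rewrite XNZ// nE (ger0_norm (ltW A0)).
apply: le_trans (lee_wpmul2l _ (leeD2r _ (XN_kconv hX))) _; rewrite ?lee_fin//.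
rewrite -(inX_fineK hX) -!EFinM lee_fin; lra.
Qed.

End Rhs.

(** * The Cauchy problem *)

Section Product.
Context (R : realType) (V : lmodType R) (S : set V) (N : V -> R).
Context (sn : seminorm_on S N).

Definition dom2 : set (V * V) := [set y | S y.1 /\ S y.2].
Definition snorm2 (y : V * V) : R := N y.1 + N y.2.

Lemma seminorm_prod : seminorm_on dom2 snorm2.
Proof.
split=> [|x y [? ?] [? ?]|a x [? ?]|x [? ?]|x y [? ?] [? ?]|a x [? ?]].
- by split; exact: (dom0 sn).
- by split; exact: (domD sn).
- by split; exact: (domZ sn).
- by rewrite addr_ge0 ?(snorm_ge0 sn).
- by rewrite /snorm2 addrACA lerD ?(snormD sn).
- by rewrite /snorm2 !(snormZ sn)// mulrDr.
Qed.

Lemma le_snorm2_fst y : dom2 y -> N y.1 <= snorm2 y.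
Proof. by case=> ? ?; rewrite lerDl (snorm_ge0 sn). Qed.

Lemma le_snorm2_snd y : dom2 y -> N y.2 <= snorm2 y.
Proof. by case=> ? ?; rewrite lerDr (snorm_ge0 sn). Qed.

Lemma complete_prod : complete_on S N -> complete_on dom2 snorm2.
Proof.
move=> cpl a C Sa aC; have D n : dom2 (a n.+1 - a n) by exact: (domB seminorm_prod).
have [||y1 [Sy1 H1]] := cpl (fun n => (a n).1) C; first by move=> n; case: (Sa n).
  by move=> n; apply: le_trans (aC n); exact: (le_snorm2_fst (D n)).
have [||y2 [Sy2 H2]] := cpl (fun n => (a n).2) C; first by move=> n; case: (Sa n).
  by move=> n; apply: le_trans (aC n); exact: (le_snorm2_snd (D n)).
exists (y1, y2); split=> // e e0; have e20 : 0 < e / 2 by rewrite divr_gt0.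
have [n1 {}H1] := H1 _ e20; have [n2 {}H2] := H2 _ e20.
exists (maxn n1 n2) => n; rewrite geq_max => /andP[nn1 nn2].
have := H1 n nn1; have := H2 n nn2; rewrite /snorm2/=; lra.
Qed.

End Product.

(** * The equation as a first order system *)

Section Equation.
Context (R : realType) (p : \bar R) (p1 : (1 <= p)%E) (alpha w : R -> R).
Local Notation mu := (@lebesgue_measure R).
Context (ia : mu.-integrable [set: R] (EFin \o alpha)).
Context (dw : forall x, derivable w x 1) (cw : continuous (derive1 w)) (w0 : w 0 = 0).

Local Notation V := (R -> R^o).
Local Notation S := (inX p : set V).
Local Notation N := (fun f : V => fine (XN p f)).
Local Notation sn := (seminorm_X p1).
Local Notation F := (rhs alpha w : V -> V).

Let mw : measurable_fun [set: R] w.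
Proof.
apply: continuous_measurable_fun => x; apply: differentiable_continuous.
exact/derivable1_diffP.
Qed.

Lemma rhs_lipschitz (M : R) : exists2 L : R, 0 <= L & forall f g : V, S f -> S g ->
  N f <= M -> N g <= M -> S (F f - F g) /\ N (F f - F g) <= L * N (f - g).
Proof.
have [M0|M0] := ltP M 0.
  exists 0 => // f g Sf _ fM _.
  by have := le_lt_trans (snorm_ge0 sn Sf) (le_lt_trans fM M0); rewrite ltxx.
have [L L0 wL] := lipschitz_on_ball dw cw (2 * M).
exists (2 * L * kmass alpha) => [|f g Sf Sg fM gM].
  by rewrite !mulr_ge0// ltW// kmass_gt0.
have [SF FL] := XN_rhs_sub p1 ia mw w0 M0 L0 wL Sf Sg fM gM.
split=> //; rewrite -lee_fin EFinM !inX_fineK//.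
exact: (domB sn Sf Sg).
Qed.

Lemma rhs0 : F 0 = 0.
Proof.
apply/funext => x; rewrite /rhs /Rintegral.
rewrite (_ : (fun y => _) = cst 0%E) ?integral0//.
by apply/funext => y; rewrite /= subrr w0 mulr0.
Qed.

(** Membership comes from the Lipschitz estimate against [F 0 = 0]. *)
Lemma inX_rhs (f : V) : S f -> S (F f).
Proof.
move=> Sf; have S0 := dom0 sn; have [L L0 FL] := rhs_lipschitz (N f).
have := FL f 0 Sf S0 (lexx _); rewrite rhs0 !subr0 => h; apply: (h _).1.
by rewrite (snorm0 sn) (snorm_ge0 sn).
Qed.

Definition vfield (y : V * V) : V * V := (y.2, F y.1).

Lemma vfield_dom (y : V * V) : dom2 S y -> dom2 S (vfield y).
Proof. by case=> S1 S2; split=> //=; exact: inX_rhs. Qed.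

Lemma vfield_lipschitz (M : R) : exists2 L : R, 0 <= L & forall y z : V * V,
  dom2 S y -> dom2 S z -> snorm2 N y <= M -> snorm2 N z <= M ->
  snorm2 N (vfield y - vfield z) <= L * snorm2 N (y - z).
Proof.
have [L L0 FL] := rhs_lipschitz M; exists (L + 1) => [|y z Sy Sz yM zM]; first lra.
have y1M := le_trans (le_snorm2_fst sn Sy) yM.
have z1M := le_trans (le_snorm2_fst sn Sz) zM.
case: Sy Sz => Sy1 Sy2 [Sz1 Sz2].
have [_ h] := FL _ _ Sy1 Sz1 y1M z1M.
have h1 : 0 <= N (y.1 - z.1) by apply: (snorm_ge0 sn); exact: (domB sn).
have h2 : 0 <= N (y.2 - z.2) by apply: (snorm_ge0 sn); exact: (domB sn).
rewrite /snorm2/= mulrDl mul1r mulrDr.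
have := mulr_ge0 L0 h2; lra.
Qed.

Lemma X_derivE (T : R) (u u' : R -> V) : (forall t, inI T t -> S (u t) /\ S (u' t)) ->
  X_deriv p T u u' <-> deriv_on N T u u'.
Proof.
move=> Su.
have key (s t : R) : inI T s -> inI T t -> s != t ->
    S (u s - u t - (s - t) *: u' t) /\
    XN p (fun x => ((u s x - u t x) / (s - t) - u' t x)%R) =
      (`|s - t|^-1 * N (u s - u t - (s - t) *: u' t))%:E.
  move=> sT tT st; have st0 : s - t != 0 by rewrite subr_eq0.
  have [Sus _] := Su s sT; have [Sut Su't] := Su t tT.
  have Sq : S (u s - u t - (s - t) *: u' t).
    by apply: (domB sn); [exact: (domB sn)|exact: (domZ sn)].
  split=> //; rewrite -normfV -(snormZ sn)// inX_fineK//; last exact: (domZ sn).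
  congr XN; apply/funext => x.
  rewrite -[RHS]/((s - t)^-1 * (u s x - u t x - (s - t) * u' t x)).
  by field.
split=> H t tT e e0; have [d [d0 Hd]] := H t tT e e0; exists d; split=> // s sT.
- have [->|st] := eqVneq s t.
    by rewrite !subrr scale0r subrr (snorm0 sn) normr0 mulr0.
  move=> std; have [_ kE] := key s t sT tT st.
  have n0 : 0 < `|s - t| by rewrite normr_gt0 subr_eq0.
  by have := Hd s sT; rewrite n0 std kE lee_fin ler_pdivrMl// mulrC => /(_ isT).
- case/andP=> st0 std; have st : s != t by rewrite -subr_eq0 -normr_gt0.
  have [_ ->] := key s t sT tT st.
  by rewrite lee_fin ler_pdivrMl// mulrC; exact: Hd.
Qed.

Lemma deriv_on_prod (T : R) (u v u' v' : R -> V) :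
  (forall t, inI T t -> S (u t) /\ S (u' t)) -> (forall t, inI T t -> S (v t) /\ S (v' t)) ->
  deriv_on (snorm2 N) T (fun t => (u t, v t)) (fun t => (u' t, v' t)) <->
  deriv_on N T u u' /\ deriv_on N T v v'.
Proof.
move=> Su Sv.
have S1 (s t : R) : inI T s -> inI T t -> S (u s - u t - (s - t) *: u' t).
  move=> /Su[? ?] /Su[? ?].
  by apply: (domB sn); [exact: (domB sn)|exact: (domZ sn)].
have S2 (s t : R) : inI T s -> inI T t -> S (v s - v t - (s - t) *: v' t).
  move=> /Sv[? ?] /Sv[? ?].
  by apply: (domB sn); [exact: (domB sn)|exact: (domZ sn)].
split=> [H|[H1 H2] t tT e e0].
  split=> t tT e e0; have [d [d0 Hd]] := H t tT e e0; exists d; split=> // s sT st;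
    apply: le_trans (Hd s sT st); rewrite /snorm2/=.
    by rewrite lerDl; apply: (snorm_ge0 sn); exact: S2.
  by rewrite lerDr; apply: (snorm_ge0 sn); exact: S1.
have e20 : 0 < e / 2 by rewrite divr_gt0.
have [d1 [d10 {}H1]] := H1 t tT _ e20; have [d2 [d20 {}H2]] := H2 t tT _ e20.
exists (Num.min d1 d2); rewrite lt_min d10 d20; split=> // s sT.
rewrite lt_min => /andP[st1 st2].
by have := H1 s sT st1; have := H2 s sT st2; rewrite /snorm2/=; lra.
Qed.

Lemma deriv_on_cont (T : R) (u u' : R -> V) : (forall t, inI T t -> S (u t) /\ S (u' t)) ->
  deriv_on N T u u' -> forall t, inI T t -> forall e : R, 0 < e -> exists d : R, 0 < d /\
    forall s, inI T s -> `|s - t| < d -> N (u s - u t) <= e.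
Proof.
move=> Su du t tT e e0; have [d [d0 Hd]] := deriv_on_growth sn Su du tT ltr01.
have [_ Su't] := Su t tT.
have c0 : 0 < N (u' t) + 1 by rewrite ltr_wpDl// (snorm_ge0 sn).
exists (Num.min d (e / (N (u' t) + 1))); rewrite lt_min d0 divr_gt0//; split=> // s sT.
rewrite lt_min ltr_pdivlMr// => /andP[sd se].
exact: le_trans (Hd s sT sd) (ltW se).
Qed.

(** Gives the continuity of [u2] for the constructed solution, and the equation at time 0 for an
    arbitrary one. *)
Lemma rhs_cont (T : R) (u u' : R -> V) : (forall t, inI T t -> S (u t) /\ S (u' t)) ->
  deriv_on N T u u' -> forall t, inI T t -> forall e : R, 0 < e -> exists d : R, 0 < d /\
    forall s, inI T s -> `|s - t| < d -> N (F (u s) - F (u t)) <= e.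
Proof.
move=> Su du t tT e e0; have [Sut _] := Su t tT.
have [L L0 FL] := rhs_lipschitz (N (u t) + 1).
have eL0 : 0 < Num.min 1 (e / (L + 1)).
  by rewrite lt_min ltr01 divr_gt0// ltr_wpDl.
have [d [d0 Hd]] := deriv_on_cont Su du tT eL0.
exists d; split=> // s sT std; have [Sus _] := Su s sT.
have := Hd s sT std; rewrite le_min => /andP[h1 h2].
have usM : N (u s) <= N (u t) + 1.
  by apply: le_trans (snorm_le_add sn Sus Sut) _; rewrite lerD2l.
have utM : N (u t) <= N (u t) + 1 by rewrite lerDl.
have [_ h] := FL _ _ Sus Sut usM utM; apply: le_trans h _.
have L10 : 0 < L + 1 by rewrite ltr_wpDl.
move: h2; rewrite ler_pdivlMr// mulrC; apply: le_trans.
rewrite ler_wpM2r ?lerDl//; apply: (snorm_ge0 sn); exact: (domB sn).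
Qed.

Lemma solution_of_flow (T : R) (phi psi : V) (y : R -> V * V) : 0 < T -> S phi -> S psi ->
  (forall t, inI T t -> dom2 S (y t)) -> snorm2 N (y 0 - (phi, psi)) = 0 ->
  deriv_on (snorm2 N) T y (vfield \o y) ->
  is_solution p alpha w T phi psi (fun t => (y t).1).
Proof.
move=> T0 Sphi Spsi Sy y0 dy; exists (fun t => (y t).2), (fun t => F (y t).1).
have Su t : inI T t -> S (y t).1 /\ S (y t).2 by exact: Sy.
have Sv t : inI T t -> S (y t).2 /\ S (F (y t).1).
  by move=> /Sy[? ?]; split=> //; exact: inX_rhs.
have [du dv] : deriv_on N T (fun t => (y t).1) (fun t => (y t).2) /\
   deriv_on N T (fun t => (y t).2) (fun t => F (y t).1).
  by apply/(deriv_on_prod Su Sv); exact: dy.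
have I0 : inI T 0 by rewrite /inI lexx ltW.
split; last first.
  split; first by move=> t tT; exact: nearW.
  have [Su0 Sv0] := Sy 0 I0.
  have S1 : S ((y 0).1 - phi) by exact: (domB sn).
  have S2 : S ((y 0).2 - psi) by exact: (domB sn).
  have N1 := snorm_ge0 sn S1; have N2 := snorm_ge0 sn S2.
  have [n1 n2] : N ((y 0).1 - phi) = 0 /\ N ((y 0).2 - psi) = 0.
    by move: y0; rewrite /snorm2/=; lra.
  split.
    by move/(fine_XN_eq0 p1 S1): n1; apply: filterS => x /eqP; rewrite subr_eq0 => /eqP.
  by move/(fine_XN_eq0 p1 S2): n2; apply: filterS => x /eqP; rewrite subr_eq0 => /eqP.
split; first by move=> t tT; have [? ?] := Su t tT; have [? ?] := Sv t tT.
split; first exact/X_derivE.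
split; first exact/X_derivE.
move=> t tT e e0; have [d [d0 Hd]] := rhs_cont Su du tT e0; exists d; split=> // s sT st.
have [_ S1] := Sv s sT; have [_ S2] := Sv t tT.
by rewrite -[leLHS](inX_fineK (domB sn S1 S2)) lee_fin; exact: Hd.
Qed.

(** Trades [u2] for [F u] in the derivative of [v]: they differ by seminorm 0 at each time, which
    the differentiability estimate cannot see. *)
Lemma flow_of_solution (T : R) (phi psi : V) (u : R -> V) : 0 < T -> S phi -> S psi ->
  is_solution p alpha w T phi psi u -> exists v : R -> V,
  [/\ forall t, inI T t -> dom2 S (u t, v t), snorm2 N ((u 0, v 0) - (phi, psi)) = 0 &
      deriv_on (snorm2 N) T (fun t => (u t, v t)) (fun t => vfield (u t, v t))].
Proof.
move=> T0 Sphi Spsi [v [u2 [[SX [du [dv cu2]]] [eqn [u0 v0]]]]]; exists v.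
have I0 : inI T 0 by rewrite /inI lexx ltW.
have Su t : inI T t -> S (u t) /\ S (v t) by case/SX => ? [].
have Sv t : inI T t -> S (v t) /\ S (u2 t) by case/SX => ? [].
have SF t : inI T t -> S (F (u t)) by case/Su => ? _; exact: inX_rhs.
have Sv' t : inI T t -> S (v t) /\ S (F (u t)).
  by move=> tT; split; [case: (Sv t tT)|exact: SF].
have {}du : deriv_on N T u v by exact/X_derivE.
have {}dv : deriv_on N T v u2 by exact/X_derivE.
have u2F0 t : inI T t -> 0 < t -> N (u2 t - F (u t)) = 0.
  move=> tT t0; have [_ Su2t] := Sv t tT; have SFt := SF t tT.
  apply/(fine_XN_eq0 p1); first exact: (domB sn).
  have tT' : 0 < t <= T by rewrite t0; case/andP: tT.
  by apply: filterS (eqn t tT') => x ux; rewrite /= -[LHS]/(u2 t x - F (u t) x) ux subrr.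
(* At [t = 0] the equation is not assumed; it follows because [u2] and [F u] are continuous there
   and agree, up to seminorm 0, at small positive times. *)
have u2F t : inI T t -> N (u2 t - F (u t)) = 0.
  move=> tT; case/andP: (tT) => + _; rewrite le_eqVlt => /predU1P[t0|]; last exact: u2F0.
  rewrite -{}t0 {t tT}.
  have [_ Su20] := Sv 0 I0; have SF0 := SF 0 I0.
  apply/eqP; rewrite eq_le (snorm_ge0 sn) ?andbT; last exact: (domB sn).
  apply/ler_addgt0Pr => e e0; rewrite add0r; have e20 : 0 < e / 2 by rewrite divr_gt0.
  have [d1 [d10 H1]] := cu2 0 I0 _ e20.
  have [d2 [d20 H2]] := rhs_cont Su du I0 e20.
  pose s := Num.min T (Num.min d1 d2 / 2).
  have d0 : 0 < Num.min d1 d2 by rewrite lt_min d10.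
  have s0 : 0 < s by rewrite lt_min T0 divr_gt0.
  have sT : inI T s by rewrite /inI ltW//= ge_min lexx.
  have sd : s < Num.min d1 d2.
    by apply: (@le_lt_trans _ _ (Num.min d1 d2 / 2)); [rewrite ge_min lexx orbT|lra].
  have [sd1 sd2] : `|s - 0| < d1 /\ `|s - 0| < d2.
    by move: sd; rewrite subr0 gtr0_norm// lt_min => /andP.
  have [_ Su2s] := Sv s sT; have SFs := SF s sT.
  have h1 : N (u2 s - u2 0) <= e / 2.
    by have := H1 s sT sd1; rewrite -[leLHS](inX_fineK (domB sn Su2s Su20)) lee_fin.
  have h2 := H2 s sT sd2.
  apply: le_trans (snorm_triangle sn (y := u2 s) Su20 Su2s SF0) _.
  apply: le_trans (lerD (lexx _) (snorm_triangle sn (y := F (u s)) Su2s SFs SF0)) _.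
  by rewrite (snormBC sn Su20 Su2s) (u2F0 s sT s0); lra.
split.
- exact: Su.
- have [Su0 Sv0] := Su 0 I0.
  have S1 : S (u 0 - phi) by exact: (domB sn).
  have S2 : S (v 0 - psi) by exact: (domB sn).
  rewrite /snorm2/= (fine_XN_eq0 p1 S1).2 ?(fine_XN_eq0 p1 S2).2 ?addr0//.
    by apply: filterS v0 => x vx; rewrite -[LHS]/(v 0 x - psi x) vx subrr.
  by apply: filterS u0 => x ux; rewrite -[LHS]/(u 0 x - phi x) ux subrr.
apply/(deriv_on_prod Su Sv'); split=> // t tT e e0.
have [d [d0 Hd]] := dv t tT e e0; exists d; split=> // s sT st.
have [Svs _] := Sv s sT; have [Svt Su2t] := Sv t tT; have SFt := SF t tT.
have S1 : S (v s - v t - (s - t) *: u2 t).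
  by apply: (domB sn); [exact: (domB sn)|exact: (domZ sn)].
have S2 : S (u2 t - F (u t)) by exact: (domB sn).
have -> : v s - v t - (s - t) *: F (u t) =
    (v s - v t - (s - t) *: u2 t) + (s - t) *: (u2 t - F (u t)).
  by rewrite scalerBr addrA subrK.
apply: le_trans (snormD sn S1 (domZ sn _ S2)) _.
by rewrite (snormZ sn _ S2) u2F// mulr0 addr0; exact: Hd.
Qed.

End Equation.

(** * Well-posedness of the Cauchy problem *)

Theorem theorem2p2 (R : realType) (p : \bar R) (alpha w : R -> R)
  (phi psi : R -> R) :
  (1 <= p)%E ->
  (@lebesgue_measure R).-integrable [set: R] (EFin \o alpha) ->
  (forall x, derivable w x 1) -> continuous (derive1 w) ->
  w 0 = 0 ->
  inX p phi -> inX p psi ->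
  exists T : R, 0 < T /\
    (* existence and uniqueness *)
    (exists u, is_solution p alpha w T phi psi u) /\
    (forall u v, is_solution p alpha w T phi psi u ->
                 is_solution p alpha w T phi psi v ->
       forall t, inI T t -> {ae @lebesgue_measure R, forall x, u t x = v t x}) /\
    (* continuous dependence on the data in C([0,T], X) *)
    (forall e : R, 0 < e -> exists d : R, 0 < d /\
       forall phi' psi', inX p phi' -> inX p psi' ->
         (XN p (fun x => (phi' x - phi x)%R) + XN p (fun x => (psi' x - psi x)%R) < d%:E)%E ->
         exists u', is_solution p alpha w T phi' psi' u' /\
           forall u, is_solution p alpha w T phi psi u ->
             forall t, inI T t -> (XN p (fun x => (u' t x - u t x)%R) <= e%:E)%E).
Proof.
move=> p1 ia dw cw w0 Sphi Spsi.
pose N (f : R -> R^o) := fine (XN p f).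
have sn := seminorm_X p1; have sn2 := seminorm_prod sn.
have [T [C [T0 C0 flow]]] := local_well_posed sn2 (complete_prod sn (complete_X p1))
  (vfield_dom p1 ia dw cw w0) (vfield_lipschitz p1 ia dw cw w0)
  (conj Sphi Spsi : dom2 (inX p : set (R -> R^o)) (phi : R -> R^o, psi : R -> R^o)).
have Sy0 : dom2 (inX p : set (R -> R^o)) (phi : R -> R^o, psi : R -> R^o) by [].
have [|y [Sy y0 dy yU]] := flow _ Sy0; first by rewrite subrr (snorm0 sn2).
exists T; split=> //.
(* Every solution with these data is at distance 0 from the constructed one, by the stability
   estimate with initial distance 0. *)
have flow_eq (u : R -> R -> R) : is_solution p alpha w T phi psi u ->
    forall t, inI T t -> inX p (u t) /\ N (u t - (y t).1 : R -> R^o) = 0.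
  move=> /(flow_of_solution p1 ia dw cw w0 T0 Sphi Spsi)[v [Sz z0 dz]] t tT.
  have := yU _ Sz dz; rewrite z0 mulr0 ltr01 => /(_ isT t tT).
  have D := domB sn2 (Sz t tT) (Sy t tT).
  move/(le_trans (le_snorm2_fst sn D)) => h; split; first by case: (Sz t tT).
  by apply/eqP; rewrite eq_le h (snorm_ge0 sn)//; case: D.
split.
  exists (fun t => (y t).1); exact: (solution_of_flow p1 ia dw cw w0 T0 Sphi Spsi Sy y0 dy).
split.
  move=> u v su sv t tT.
  have [Sut ut] := flow_eq u su t tT; have [Svt vt] := flow_eq v sv t tT.
  have [Syt _] := Sy t tT.
  have : N (u t - v t : R -> R^o) = 0.
    apply/eqP; rewrite eq_le (snorm_ge0 sn (domB sn Sut Svt)) andbT.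
    apply: le_trans (snorm_triangle sn Sut Syt Svt) _.
    by rewrite [X in X + _]ut (snormBC sn Syt Svt) [X in _ + X]vt addr0.
  move/(fine_XN_eq0 p1 (domB sn Sut Svt)).
  by apply: filterS => x /eqP; rewrite subr_eq0 => /eqP.
move=> e e0.
(* [d <= 1] keeps the perturbed data in the ball of uniform existence; [C * d <= e] is the final
   estimate, and [C * d <= 1 / 2] meets the smallness condition of the stability estimate. *)
pose d := Num.min 1 (Num.min e (1 / 2) / C).
have d0 : 0 < d by rewrite lt_min ltr01 divr_gt0// lt_min e0 divr_gt0.
have d1 : d <= 1 by rewrite ge_min lexx.
have Cd : C * d <= Num.min e (1 / 2).
  by rewrite mulrC -ler_pdivlMr// ge_min lexx orbT.
exists d; split=> // phi' psi' Sphi' Spsi' dd.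
have Sy0' : dom2 (inX p : set (R -> R^o)) (phi' : R -> R^o, psi' : R -> R^o) by [].
have dy0 : snorm2 N ((phi' : R -> R^o, psi' : R -> R^o) - (phi : R -> R^o, psi : R -> R^o)) < d.
  rewrite -lte_fin /snorm2 EFinD /N/=.
  rewrite (inX_fineK (domB sn Sphi' Sphi)) (inX_fineK (domB sn Spsi' Spsi)).
  exact: dd.
have [|y' [Sy' y0' dy' yU']] := flow _ Sy0'; first exact: le_trans (ltW dy0) d1.
exists (fun t => (y' t).1); split.
  exact: (solution_of_flow p1 ia dw cw w0 T0 Sphi' Spsi' Sy' y0' dy').
(* The roles are exchanged: the solution [u] of the original problem is the competitor of the flow
   [y'] from the perturbed data. *)
move=> u /(flow_of_solution p1 ia dw cw w0 T0 Sphi Spsi)[v [Sz z0 dz]] t tT.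
have I0 : inI T 0 by rewrite /inI lexx ltW.
have z0d : snorm2 N ((u 0 : R -> R^o, v 0) - (phi' : R -> R^o, psi' : R -> R^o)) <= d.
  apply: le_trans (snorm_triangle sn2 (Sz 0 I0) Sy0 Sy0') _.
  by rewrite [X in X + _]z0 add0r (snormBC sn2 Sy0 Sy0') ltW.
have Cz : C * snorm2 N ((u 0 : R -> R^o, v 0) - (phi' : R -> R^o, psi' : R -> R^o)) <=
    Num.min e (1 / 2).
  by apply: le_trans Cd; rewrite ler_wpM2l// ltW.
have [Ce Ch] : C * snorm2 N ((u 0 : R -> R^o, v 0) - (phi' : R -> R^o, psi' : R -> R^o)) <= e /\
   C * snorm2 N ((u 0 : R -> R^o, v 0) - (phi' : R -> R^o, psi' : R -> R^o)) < 1.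
  by move: Cz; rewrite le_min => /andP[? ?]; split=> //; lra.
have := yU' _ Sz dz Ch t tT => /le_trans/(_ Ce).
have D := domB sn2 (Sz t tT) (Sy' t tT).
move/(le_trans (le_snorm2_fst sn D)) => h.
have [Sut _] := Sz t tT; have [Sy't _] := Sy' t tT.
rewrite -[leLHS](inX_fineK (domB sn Sy't Sut)) lee_fin.
by rewrite (snormBC sn Sy't Sut).
Qed.
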